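(* Let $T=(T_1,\ldots,T_n)\in B(\mathcal H)^n$ be a quasi-nilpotent $n$-tuple of operators. Then there exists a quasi-nilpotent weighted left multi-shift $W=(W_1,\ldots,W_n)$ with the following properties. (i) $\|f(T_1,\ldots,T_n)\|\le\frac{\pi}{\sqrt6}\|f(W_1,\ldots,W_n)\|$ for any $f\in\mathrm{Hol}_0(Z)$. (ii) $r(f(T_1,\ldots,T_n))\le r(f(W_1,\ldots,W_n))$ for any $f\in\mathrm{Hol}_0(Z)$, where $r$ denotes the spectral radius. (iii) Let $f_k,f\in\mathrm{Hol}_0(Z)$ be such that $\{\|f_k(W_1,\ldots,W_n)\|\}_k$ is a bounded sequence and $f_k(W_1,\ldots,W_n)\to f(W_1,\ldots,W_n)$ as $k\to\infty$ in the operator norm (resp. WOT-, $w^*$-, SOT-) topology. Then $f_k(T_1,\ldots,T_n)\to f(T_1,\ldots,T_n)$ in the corresponding topology, respectively. In particular, if $f(S_1,\ldots,S_n)\in F^\infty(H_n)$, then $$\|f(T_1,\ldots,T_n)\|\le\frac{\pi}{\sqrt6}M\|f(S_1,\ldots,S_n)\|,$$ where $M$ is the power bound of $W$.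
   Context: $\mathbb F_n^+$ is the unital free semigroup on generators $g_1,\ldots,g_n$ with identity $g_0$; $|\alpha|$ is the length of $\alpha$. $F^2(H_n)$ is the full Fock space, a Hilbert space with orthonormal basis $\{e_\alpha\}_{\alpha\in\mathbb F_n^+}$; the left creation operators are $S_ie_\alpha=e_{g_i\alpha}$. For operators, $T_\alpha:=T_{i_1}\cdots T_{i_k}$ if $\alpha=g_{i_1}\cdots g_{i_k}$, $T_{g_0}:=I$. A weighted left multi-shift is an $n$-tuple on $F^2(H_n)$ of the form $W_ie_\alpha=\mu_{g_i\alpha}e_{g_i\alpha}$ with $\mu_\beta\ge0$ and $\sup_\alpha\mu_{g_i\alpha}<\infty$ for each $i$. An $n$-tuple $T$ is quasi-nilpotent if its joint spectral radius $\lim_k\|\sum_{|\alpha|=k}T_\alpha T_\alpha^*\|^{1/2k}$ is $0$. The power bound of $W$ is $M:=\sup_{k\ge0}\|\sum_{|\alpha|=k}W_\alpha W_\alpha^*\|^{1/2}$. $\mathrm{Hol}_0(Z)$ is the algebra of formal power series $f=\sum_\alpha c_\alpha Z_\alpha$ in noncommuting indeterminates with $\limsup_{k\to\infty}\big(\sum_{|\alpha|=k}|c_\alpha|^2\big)^{1/2k}<\infty$ (free holomorphic functions on a neighborhood of the origin). For $f\in\mathrm{Hol}_0(Z)$ and quasi-nilpotent $T$, $f(T_1,\ldots,T_n):=\sum_{k=0}^\infty\sum_{|\alpha|=k}c_\alpha T_\alpha$, a series convergent in norm. $F^\infty(H_n)$ is the noncommutative analytic Toeplitz algebra, the $w^*$-closed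 algebra generated by $S_1,\ldots,S_n,I$; ''$f(S_1,\ldots,S_n)\in F^\infty(H_n)$'' means that $f=\sum_\alpha c_\alpha Z_\alpha$ is such that $\sum_\alpha c_\alpha S_\alpha p$ defines, on $p\in\mathrm{span}\{e_\alpha\}$, a bounded operator whose extension is denoted $f(S_1,\ldots,S_n)$. *)

(* Defs.v *)
From HB Require Import structures.
From mathcomp Require Import all_boot all_order all_algebra.
From mathcomp Require Import sesquilinear complex.
From mathcomp Require Import all_classical all_reals all_analysis.
From mathcomp Require Import ring lra.

Set Implicit Arguments.
Unset Strict Implicit.
Unset Printing Implicit Defensive.

Import Order.TTheory GRing.Theory Num.Theory Num.Def.
Import numFieldNormedType.Exports.

Local Open Scope classical_set_scope.
Local Open Scope ring_scope.
Local Open Scope complex_scope.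

(* MathComp norms on a module over R[i] are R[i]-valued; nrm is the same norm
   with values in R. *)
Definition nrm (R : realType) (V : normedZmodType R[i]) (x : V) : R :=
  complex.Re `|x|.

Section nrm_theory.
Variable R : realType.

Lemma nrmE (V : normedZmodType R[i]) (x : V) : `|x| = (nrm x)%:C.
Proof. by rewrite /nrm RRe_real// ger0_real. Qed.

Lemma nrm_ge0 (V : normedZmodType R[i]) (x : V) : 0 <= nrm x.
Proof. by rewrite -ler0c -nrmE. Qed.

Lemma nrm0 (V : normedZmodType R[i]) : nrm (0 : V) = 0.
Proof. by rewrite /nrm normr0. Qed.

Lemma nrm0_eq0 (V : normedZmodType R[i]) (x : V) : nrm x = 0 -> x = 0.
Proof. by move=> x0; apply/normr0_eq0; rewrite nrmE x0. Qed.

Lemma nrmD (V : normedZmodType R[i]) (x y : V) : nrm (x + y) <= nrm x + nrm y.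
Proof. by rewrite -lecR rmorphD/= -!nrmE ler_normD. Qed.

Lemma nrmZ (V : normedModType R[i]) (a : R[i]) (x : V) :
  nrm (a *: x) = nrm a * nrm x.
Proof. by apply: complexI; rewrite rmorphM/= -!nrmE normrZ. Qed.

End nrm_theory.

(* The inner product is linear in its first argument and conjugate-linear in
   the second one. *)
HB.mixin Record isHilbert (R : realType) H & CompleteNormedModule R[i] H := {
  dotp : {dot H for conjC};
  dotp_norm : forall x, dotp x x = `|x| ^+ 2
}.

#[short(type="hilbertType")]
HB.structure Definition Hilbert (R : realType) :=
  {H of CompleteNormedModule R[i] H & isHilbert R H}.

Section bounded_operators.
Variables (R : realType) (V : normedModType R[i]).

Definition bounded_linear : {pred V -> V} :=
  [pred f | `[< linear f /\ exists M : R, forall x, nrm (f x) <= M * nrm x >]].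

(* The bounded operators on V: an R[i]-module and a ring for composition
   (only a pzRing, since 1 = 0 when V is the zero space), normed below by the
   operator norm. *)
Record bop := BOp { bop_fun :> V -> V; _ : bop_fun \in bounded_linear }.

HB.instance Definition _ := [isSub for bop_fun].
HB.instance Definition _ := [Choice of bop by <:].

Lemma bopP (A B : bop) : A =1 B -> A = B.
Proof. by move=> AB; apply/val_inj/funext. Qed.

Lemma bop_linear (A : bop) : linear A.
Proof. by case: A => f /= /asboolP[]. Qed.

HB.instance Definition _ (A : bop) :=
  GRing.isLinear.Build R[i] V V *:%R A (bop_linear A).

Lemma bop_bounded (A : bop) :
  exists2 M : R, 0 <= M & forall x, nrm (A x) <= M * nrm x.
Proof.
case: A => f /= /asboolP[_ [M fM]]; exists `|M| => // x.
by rewrite (le_trans (fM x))// ler_wpM2r ?nrm_ge0 ?ler_norm.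
Qed.

Lemma bounded_linear_submod : submod_closed bounded_linear.
Proof.
split.
  apply/asboolP; split => [a x y|]; first by change (0 = a *: (0 : V) + 0); rewrite scaler0 addr0.
  by exists 0 => x; rewrite mul0r [nrm _]nrm0.
move=> a f g /asboolP[lf [M fM]] /asboolP[lg [N gN]]; apply/asboolP; split.
  move=> b x y; change (a *: f (b *: x + y) + g (b *: x + y) =
    b *: (a *: f x + g x) + (a *: f y + g y)).
  rewrite lf lg !scalerDr !scalerA (mulrC a b).
  by rewrite -!addrA; congr (_ + _); rewrite addrCA.
exists (nrm a * M + N) => x; rewrite (le_trans (nrmD _ _))//.
by rewrite mulrDl lerD// nrmZ -mulrA ler_wpM2l ?nrm_ge0.
Qed.

HB.instance Definition _ :=
  GRing.isSubmodClosed.Build R[i] (V -> V) bounded_linear bounded_linear_submod.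
HB.instance Definition _ := [SubChoice_isSubLmodule of bop by <:].

Lemma bounded_linear_id : idfun \in bounded_linear.
Proof. by apply/asboolP; split => //; exists 1 => x; rewrite mul1r. Qed.

Lemma bounded_linear_comp (A B : bop) : A \o B \in bounded_linear.
Proof.
apply/asboolP; split => [a x y|]; first by rewrite /= !linearP.
have [M M0 AM] := bop_bounded A; have [N N0 BN] := bop_bounded B.
exists (M * N) => x /=; rewrite (le_trans (AM _))// -mulrA.
exact: ler_wpM2l.
Qed.

Definition bop_one := BOp bounded_linear_id.
Definition bop_mul (A B : bop) := BOp (bounded_linear_comp A B).

Lemma bop_mulA : associative bop_mul.
Proof. by move=> A B D; apply: bopP. Qed.
Lemma bop_mul1 : left_id bop_one bop_mul.
Proof. by move=> A; apply: bopP. Qed.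
Lemma bop_mulr1 : right_id bop_one bop_mul.
Proof. by move=> A; apply: bopP. Qed.
Lemma bop_mulDl : left_distributive bop_mul +%R.
Proof. by move=> A B D; apply: bopP. Qed.
Lemma bop_mulDr : right_distributive bop_mul +%R.
Proof. by move=> A B D; apply: bopP => x; exact: linearD. Qed.

HB.instance Definition _ := GRing.Zmodule_isPzRing.Build bop
  bop_mulA bop_mul1 bop_mulr1 bop_mulDl bop_mulDr.

Definition opnorm (A : bop) : R :=
  sup [set nrm (A x) | x in [set x | nrm x <= 1]].

Lemma opnorm_ubound (A : bop) :
  has_ubound [set nrm (A x) | x in [set x | nrm x <= 1]].
Proof.
have [M M0 AM] := bop_bounded A; exists M => _ [x /= x1 <-].
by rewrite (le_trans (AM x))// ler_piMr.
Qed.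

Lemma opnorm_ge0 (A : bop) : 0 <= opnorm A.
Proof.
apply: (@le_trans _ _ (nrm (A 0))); first exact: nrm_ge0.
by apply: ub_le_sup; [exact: opnorm_ubound|exists 0 => //=; rewrite nrm0].
Qed.

Lemma le_opnorm (A : bop) x : nrm (A x) <= opnorm A * nrm x.
Proof.
have [->|x0] := eqVneq x 0; first by rewrite linear0 !nrm0 mulr0.
have nx : 0 < nrm x.
  by rewrite lt_def nrm_ge0 andbT; apply: contra_neq x0 => /nrm0_eq0.
have nV : nrm ((nrm x)^-1)%:C = (nrm x)^-1.
  by rewrite /nrm normc_def/= expr0n addr0 sqrtr_sqr ger0_norm// invr_ge0 nrm_ge0.
rewrite -ler_pdivrMr// mulrC -{1}nV -nrmZ -linearZ/=.
apply: ub_le_sup; first exact: opnorm_ubound.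
by eexists; last reflexivity; rewrite /= nrmZ nV mulVf// gt_eqF.
Qed.

Lemma opnorm_le (A : bop) M : 0 <= M ->
  (forall x, nrm (A x) <= M * nrm x) -> opnorm A <= M.
Proof.
move=> M0 AM; apply: ge_sup; first by exists (nrm (A 0)), 0 => //=; rewrite nrm0.
by move=> _ [x /= x1 <-]; rewrite (le_trans (AM x))// ler_piMr.
Qed.

Lemma opnormD (A B : bop) : (opnorm (A + B))%:C <= (opnorm A)%:C + (opnorm B)%:C.
Proof.
rewrite -rmorphD lecR; apply: opnorm_le; first by rewrite addr_ge0 ?opnorm_ge0.
move=> x; rewrite (le_trans (nrmD _ _))//.
by rewrite mulrDl lerD// le_opnorm.
Qed.

Lemma opnormZ (a : R[i]) (A : bop) : (opnorm (a *: A))%:C = `|a| * (opnorm A)%:C.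
Proof.
have le (b : R[i]) (B : bop) : opnorm (b *: B) <= nrm b * opnorm B.
  apply: opnorm_le => [|x]; first by rewrite mulr_ge0 ?nrm_ge0 ?opnorm_ge0.
  by rewrite [(b *: B) x]/(b *: B x) nrmZ -mulrA ler_wpM2l ?nrm_ge0 ?le_opnorm.
rewrite nrmE -rmorphM; congr (_%:C); apply/eqP; rewrite eq_le le/=.
have [->|a0] := eqVneq a 0; first by rewrite nrm0 mul0r opnorm_ge0.
have na : nrm a * nrm a^-1 = 1.
  by apply: complexI; rewrite rmorphM/= -!nrmE -normrM divff// normr1.
have := le a^-1 (a *: A); rewrite scalerA mulVf// scale1r.
by move=> /(ler_wpM2l (nrm_ge0 a)); rewrite mulrA na mul1r.
Qed.

Lemma opnorm0_eq0 (A : bop) : (opnorm A)%:C = 0 -> A = 0.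
Proof.
move=> [A0]; apply: bopP => x; apply: nrm0_eq0; apply/eqP.
by rewrite eq_le nrm_ge0 andbT (le_trans (le_opnorm _ _))// A0 mul0r.
Qed.

HB.instance Definition _ := Lmodule_isNormed.Build R[i] bop
  opnormD opnormZ opnorm0_eq0.

Lemma nrm_opnorm (A : bop) : nrm A = opnorm A.
Proof. by []. Qed.

End bounded_operators.

Section level_sums.
Variables (R : realType) (n : nat).
Implicit Types u v : seq 'I_n -> R.

(* A word of the free semigroup on n generators is a sequence over 'I_n, the
   identity being [::]; the words of length k are summed first. *)
Definition level u (k : nat) : R := \sum_(a : k.-tuple 'I_n) u a.

Definition level_sum u : R := limn (series (level u)).

Lemma levelD u v : level (fun a => u a + v a) = level u + level v.
Proof. by apply/funext => k; rewrite /level fctE big_split. Qed.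

Lemma levelZ c u : level (fun a => c * u a) = c *: level u.
Proof. by apply/funext => k; rewrite /level fctE -mulr_sumr. Qed.

Lemma level_ge0 u : (forall a, 0 <= u a) -> forall k, 0 <= level u k.
Proof. by move=> u0 k; rewrite /level sumr_ge0. Qed.

Lemma level_sumD u v : cvgn (series (level u)) -> cvgn (series (level v)) ->
  level_sum (fun a => u a + v a) = level_sum u + level_sum v.
Proof. by move=> cu cv; rewrite /level_sum levelD lim_seriesD. Qed.

Lemma level_sumZ c u : cvgn (series (level u)) ->
  level_sum (fun a => c * u a) = c * level_sum u.
Proof. by move=> cu; rewrite /level_sum levelZ lim_seriesZ. Qed.

Lemma level_cvgD u v : cvgn (series (level u)) -> cvgn (series (level v)) ->
  cvgn (series (level (fun a => u a + v a))).
Proof. by move=> cu cv; rewrite levelD; exact: is_cvg_seriesD. Qed.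

Lemma level_cvgZ c u : cvgn (series (level u)) ->
  cvgn (series (level (fun a => c * u a))).
Proof. by move=> cu; rewrite levelZ; exact: is_cvg_seriesZ. Qed.

Lemma level_sum_lin p q u v w : cvgn (series (level u)) ->
  cvgn (series (level v)) -> cvgn (series (level w)) ->
  level_sum (fun a => p * u a + q * v a + w a) =
  p * level_sum u + q * level_sum v + level_sum w.
Proof.
move=> cu cv cw; have cpu := @level_cvgZ p u cu; have cqv := @level_cvgZ q v cv.
rewrite level_sumD//; last exact: level_cvgD.
by rewrite level_sumD// !level_sumZ.
Qed.

Lemma level_cvg_le u v : (forall a, `|u a| <= v a) ->
  cvgn (series (level v)) -> cvgn (series (level u)).
Proof.
move=> uv cv; apply: (@normed_cvg R R^o).
have v0 a : 0 <= v a by rewrite (le_trans (normr_ge0 _) (uv a)).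
apply: series_le_cvg cv => k; [exact: normr_ge0|exact: level_ge0|].
by rewrite (le_trans (ler_norm_sum _ _ _))// ler_sum.
Qed.

Lemma level_partial_le u N : (forall a, 0 <= u a) ->
  cvgn (series (level u)) -> series (level u) N <= level_sum u.
Proof.
move=> u0 cu; apply: nondecreasing_cvgn_le => //.
by apply: nondecreasing_series => k _ _; exact: level_ge0.
Qed.

Lemma level_sum_ge0 u : (forall a, 0 <= u a) ->
  cvgn (series (level u)) -> 0 <= level_sum u.
Proof.
move=> u0 cu; apply: le_trans (level_partial_le 0 u0 cu).
by rewrite /series/= big_geq.
Qed.

Lemma level_term_le u a : (forall a, 0 <= u a) ->
  cvgn (series (level u)) -> u a <= level_sum u.
Proof.
move=> u0 cu; apply: le_trans (level_partial_le (size a).+1 u0 cu).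
rewrite /series/= big_nat_recr//= -[leLHS]add0r lerD//.
  by rewrite sumr_ge0// => k _; exact: level_ge0.
by rewrite /level (bigD1 (in_tuple a))//= lerDl sumr_ge0.
Qed.

End level_sums.

Section fock.
Variables (R : realType) (n : nat).

Definition square_summable : {pred seq 'I_n -> R[i]^o} :=
  [pred f | `[< cvgn (series (level (fun a => nrm (f a) ^+ 2))) >]].

(* The full Fock space on n generators, as the space l^2 of words: e_a is the
   family fock_basis a below. *)
Record fock := Fock {
  fock_fun :> seq 'I_n -> R[i]^o; _ : fock_fun \in square_summable }.

HB.instance Definition _ := [isSub for fock_fun].
HB.instance Definition _ := [Choice of fock by <:].

Lemma fockP (f g : fock) : f =1 g -> f = g.
Proof. by move=> fg; apply/val_inj/funext. Qed.

Lemma fock_cvg (f : fock) : cvgn (series (level (fun a => nrm (f a) ^+ 2))).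
Proof. by case: f => f /= /asboolP. Qed.

Lemma square_summable_submod : submod_closed square_summable.
Proof.
split.
  apply/asboolP; rewrite (_ : series _ = cst 0); first exact: is_cvg_cst.
  apply/funext => N; rewrite /series/= big1// => k _; rewrite /level big1// => a _.
  by rewrite [nrm _](@nrm0 R R[i]^o) expr0n.
move=> c f g /asboolP cf /asboolP cg; apply/asboolP.
apply: (@level_cvg_le _ _ _ (fun a => 2 * nrm c ^+ 2 * nrm (f a) ^+ 2 +
    2 * nrm (g a) ^+ 2)) => [a|]; last first.
  by apply: level_cvgD; exact: level_cvgZ.
rewrite ger0_norm ?sqr_ge0// [X in nrm X](_ : _ = c *: f a + g a)//.
have h : nrm (c *: f a + g a) <= nrm c * nrm (f a) + nrm (g a).
  by rewrite (le_trans (nrmD _ _))// nrmZ.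
apply: (@le_trans _ _ ((nrm c * nrm (f a) + nrm (g a)) ^+ 2)).
  by rewrite ler_sqr ?nnegrE ?addr_ge0 ?mulr_ge0 ?nrm_ge0.
rewrite -subr_ge0 (_ : _ - _ = (nrm c * nrm (f a) - nrm (g a)) ^+ 2) ?sqr_ge0//.
by ring.
Qed.

HB.instance Definition _ := GRing.isSubmodClosed.Build R[i]
  (seq 'I_n -> R[i]^o) square_summable square_summable_submod.
HB.instance Definition _ := [SubChoice_isSubLmodule of fock by <:].

(* The series for <f, g> converges absolutely; it is summed on real and
   imaginary parts. *)
Definition fock_dot (f g : fock) : R[i] :=
  level_sum (fun a => complex.Re ((f a : R[i]) * (g a : R[i])^*)) +i*
  level_sum (fun a => complex.Im ((f a : R[i]) * (g a : R[i])^*)).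

Lemma nrm_sqr (z : R[i]^o) : nrm z ^+ 2 = complex.Re z ^+ 2 + complex.Im z ^+ 2.
Proof.
by rewrite /nrm normc_def/= sqr_sqrtr// addr_ge0 ?sqr_ge0.
Qed.

Lemma fock_dot_bound (f g : fock) a :
  `|complex.Re ((f a : R[i]) * (g a : R[i])^*)| <= nrm (f a) ^+ 2 + nrm (g a) ^+ 2 /\
  `|complex.Im ((f a : R[i]) * (g a : R[i])^*)| <= nrm (f a) ^+ 2 + nrm (g a) ^+ 2.
Proof.
rewrite !nrm_sqr; case: (f a) (g a) => [x y] [z t] /=.
have := (sqr_ge0 (x - z), sqr_ge0 (x + z), sqr_ge0 (y - t), sqr_ge0 (y + t)).
have := (sqr_ge0 (x - t), sqr_ge0 (x + t), sqr_ge0 (y - z), sqr_ge0 (y + z)).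
have := (sqr_ge0 x, sqr_ge0 y, sqr_ge0 z, sqr_ge0 t).
move=> [[[? ?] ?] ?] [[[? ?] ?] ?] [[[? ?] ?] ?].
by split; rewrite ler_norml; apply/andP; split; nra.
Qed.

Lemma fock_dot_cvg (f g : fock) :
  cvgn (series (level (fun a => complex.Re ((f a : R[i]) * (g a : R[i])^*)))) /\
  cvgn (series (level (fun a => complex.Im ((f a : R[i]) * (g a : R[i])^*)))).
Proof.
have c := level_cvgD (@fock_cvg f) (@fock_cvg g).
by split; apply: level_cvg_le c => a; have [] := fock_dot_bound f g a.
Qed.

Lemma fock_dotC (f g : fock) : fock_dot f g = (-1) ^+ false * conjC (fock_dot g f).
Proof.
have [cr ci] := fock_dot_cvg g f.
rewrite expr0 mul1r.
change (fock_dot f g = (fock_dot g f)^*); rewrite /fock_dot/=; congr (_ +i* _).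
  by congr level_sum; apply/funext => a;
    case: (f a) (g a) => [x y] [z t] /=; ring.
rewrite -[RHS]mulN1r -level_sumZ//; congr level_sum; apply/funext => a.
by case: (f a) (g a) => [x y] [z t] /=; ring.
Qed.

Lemma fock_dot_linear (h : fock) : linear_for *%R (fock_dot ^~ h).
Proof.
move=> c f g.
have [frc fic] := fock_dot_cvg f h; have [grc gic] := fock_dot_cvg g h.
case: c => p q; set c := p +i* q.
transitivity
  ((p * complex.Re (fock_dot f h) + - q * complex.Im (fock_dot f h) +
      complex.Re (fock_dot g h)) +i*
   (p * complex.Im (fock_dot f h) + q * complex.Re (fock_dot f h) +
      complex.Im (fock_dot g h))); last first.
  case: (fock_dot f h) (fock_dot g h) => [x y] [z t] /=.
  by apply/eqP; rewrite eq_complex/=; apply/andP; split; apply/eqP; ring.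
rewrite /fock_dot/=.
rewrite -(level_sum_lin p (- q) frc fic grc) -(level_sum_lin p q fic frc gic).
congr (_ +i* _); congr level_sum; apply/funext => a.
  transitivity (complex.Re ((c * (f a : R[i]) + g a) * (h a : R[i])^*)) => //.
  by rewrite /c; case: (f a) (g a) (h a) => [x y] [z t] [v w] /=; ring.
transitivity (complex.Im ((c * (f a : R[i]) + g a) * (h a : R[i])^*)) => //.
by rewrite /c; case: (f a) (g a) (h a) => [x y] [z t] [v w] /=; ring.
Qed.

Lemma fock_dot_bilinear :
  @bilinear_for R[i] fock fock R[i] ( *%R : GRing.Scale.law _ _)
    ((conjC \; *%R) : GRing.Scale.law _ _) fock_dot.
Proof.
split=> [h|h] c f g; first exact: fock_dot_linear.
rewrite !(fock_dotC h) !expr0 !mul1r fock_dot_linear rmorphD/= rmorphM/=.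
by [].
Qed.

HB.instance Definition _ := bilinear_isBilinear.Build R[i] fock fock R[i] _ _
  fock_dot fock_dot_bilinear.
HB.instance Definition _ :=
  isHermitianSesquilinear.Build R[i] fock false conjC fock_dot fock_dotC.

Definition fock_norm (f : fock) : R :=
  Num.sqrt (level_sum (fun a => nrm (f a) ^+ 2)).

Lemma fock_norm_sqr f : fock_norm f ^+ 2 = level_sum (fun a => nrm (f a) ^+ 2).
Proof.
rewrite sqr_sqrtr// level_sum_ge0//; last exact: fock_cvg.
by move=> a; rewrite sqr_ge0.
Qed.

Lemma fock_dotE f : fock_dot f f = ((fock_norm f) ^+ 2)%:C.
Proof.
rewrite fock_norm_sqr /fock_dot; congr (_ +i* _).
  congr level_sum; apply/funext => a; rewrite nrm_sqr.
  by case: (f a) => x y /=; ring.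
rewrite -[RHS](mul0r (level_sum (fun a => nrm (f a) ^+ 2))) -level_sumZ; last exact: fock_cvg.
congr level_sum; apply/funext => a.
by case: (f a) => x y /=; ring.
Qed.

Lemma fock_coef_le (f : fock) a : nrm (f a) <= fock_norm f.
Proof.
rewrite -ler_sqr ?nnegrE ?nrm_ge0 ?sqrtr_ge0// fock_norm_sqr.
apply: (level_term_le (u := fun a => nrm (f a) ^+ 2)); last exact: fock_cvg.
by move=> ?; rewrite sqr_ge0.
Qed.

Lemma fock_norm0_eq0 f : (fock_norm f)%:C = 0 -> f = 0.
Proof.
move=> [f0]; apply: fockP => a; apply/nrm0_eq0/eqP.
by rewrite eq_le nrm_ge0 andbT -f0 fock_coef_le.
Qed.

Lemma fock_dot_gt0 f : f != 0 -> 0 < fock_dot f f.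
Proof.
move=> f0; rewrite fock_dotE ltcR exprn_gt0// lt_def sqrtr_ge0 andbT.
by apply: contra_neq f0 => f0; apply: fock_norm0_eq0; rewrite f0.
Qed.

HB.instance Definition _ :=
  isDotProduct.Build R[i] fock fock_dot fock_dot_gt0.

Lemma fock_norm_dot f : fock_norm f = Num.sqrt (complex.Re (fock_dot f f)).
Proof. by rewrite fock_dotE/= sqrtr_sqr ger0_norm// sqrtr_ge0. Qed.

Lemma fock_normZ (c : R[i]) f : (fock_norm (c *: f))%:C = `|c| * (fock_norm f)%:C.
Proof.
rewrite nrmE -rmorphM; congr (_%:C).
rewrite /fock_norm -[nrm c in RHS]ger0_norm ?nrm_ge0// -sqrtr_sqr -sqrtrM ?sqr_ge0//.
rewrite -level_sumZ; last exact: fock_cvg.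
congr (Num.sqrt (level_sum _)); apply/funext => a.
by rewrite -exprMn -(@nrmZ R R[i]^o).
Qed.

Lemma fock_normD f g :
  (fock_norm (f + g))%:C <= (fock_norm f)%:C + (fock_norm g)%:C.
Proof.
rewrite -rmorphD lecR.
rewrite -ler_sqr ?nnegrE ?addr_ge0 ?sqrtr_ge0//.
have [d dE] : exists d, d = fock_dot f g by eexists.
have fgE (t : R) : fock_norm (f + t%:C *: g) ^+ 2 =
    fock_norm f ^+ 2 + t * 2 * complex.Re d + t ^+ 2 * fock_norm g ^+ 2.
  apply: complexI; rewrite -fock_dotE.
  have tC : `|t%:C| ^+ 2 = (t ^+ 2)%:C.
    rewrite normc_def /= expr0n/= addr0 sqrtr_sqr -rmorphXn/=.
    by rewrite real_normK ?num_real.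
  rewrite (dnormD fock_dot) (dnormZ fock_dot) linearZ_LR/= tC !fock_dotE.
  rewrite -dE; case: d {dE} => x y.
  by apply/eqP; rewrite eq_complex/=; apply/andP; split; apply/eqP; ring.
have := fgE 1; rewrite scale1r => ->.
set p := fock_norm f in fgE *; set q := fock_norm g in fgE *.
set r := complex.Re _ in fgE *.
have p0 : 0 <= p := sqrtr_ge0 _; have q0 : 0 <= q := sqrtr_ge0 _.
suff : r <= p * q by nra.
have t0 t : 0 <= p ^+ 2 + t * 2 * r + t ^+ 2 * q ^+ 2 by rewrite -fgE sqr_ge0.
have [qE|qN] := eqVneq q 0.
  rewrite qE mulr0 leNgt; apply/negP => r0.
  have := t0 (- (p ^+ 2 + 1) / (2 * r)); rewrite qE expr0n/= mulr0 addr0.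
  rewrite -mulrA mulfVK; last by rewrite mulf_neq0// gt_eqF.
  lra.
have := t0 (- (r / q ^+ 2)).
rewrite (_ : _ + _ = p ^+ 2 - r ^+ 2 / q ^+ 2); last by field.
rewrite subr_ge0 ler_pdivrMr ?exprn_gt0 ?lt_def ?qN// -exprMn => h.
rewrite (le_trans (ler_norm r))// -ler_sqr ?nnegrE ?mulr_ge0//.
by rewrite real_normK ?num_real.
Qed.

HB.instance Definition _ := Lmodule_isNormed.Build R[i] fock
  fock_normD fock_normZ fock_norm0_eq0.

Lemma nrm_fock (f : fock) : nrm f = fock_norm f.
Proof. by []. Qed.

End fock.

Section fock_complete.
Variables (R : realType) (n : nat).
Local Notation F2 := (fock R n).

Lemma cvg_bigsum T (F : set_system T) (FF : Filter F) (I : Type) (r : seq I)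
    (f : I -> T -> R) (l : I -> R) : (forall i, f i @ F --> l i) ->
  (fun x => \sum_(i <- r) f i x) @ F --> \sum_(i <- r) l i.
Proof.
move=> fl; elim: r => [|i r IH].
  rewrite big_nil (_ : (fun x => _) = cst 0); first exact: cvg_cst.
  by apply/funext => x; rewrite big_nil.
rewrite big_cons (_ : (fun x => _) = f i + (fun x => \sum_(i <- r) f i x)).
  exact: cvgD.
by apply/funext => x; rewrite big_cons.
Qed.

Lemma cauchy_fock_ex (F : set_system F2) : ProperFilter F -> cauchy F ->
  forall e : R, 0 < e -> exists g : F2, F [set h | nrm (g - h) <= e].
Proof.
move=> FF /cauchyP Fc e e0.
have eC : 0 < e%:C by rewrite ltcR.
have [g Fg] := Fc _ eC; exists g; apply: filterS Fg => h.
by rewrite -ball_normE /= nrmE ltcR => /ltW.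
Qed.

Lemma fock_coefB (f g : F2) a : (f - g) a = (f a : R[i]) - (g a : R[i]).
Proof. by []. Qed.

Lemma cauchy_fock_coef (F : set_system F2) (p : R[i] -> R) :
  (forall x y, p x - p y = p (x - y)) -> (forall x, `|p x| <= nrm x) ->
  ProperFilter F -> cauchy F ->
  forall a, cvg ((fun f : F2 => p (f a)) @ F).
Proof.
move=> pB pn FF Fc a; apply/cauchy_cvgP/cauchy_exP => e e0.
have [g Fg] := cauchy_fock_ex FF Fc (divr_gt0 e0 (ltr0Sn R 1)).
exists (p (g a)); change (F [set h : F2 | ball (p (g a)) e (p (h a))]).
apply: filterS Fg => h /= gh.
change (`|p (g a) - p (h a)| < e); rewrite pB (le_lt_trans (pn _))//.
rewrite -fock_coefB (le_lt_trans (fock_coef_le (g - h) a))//.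
by rewrite (le_lt_trans gh)// ltr_pdivrMr// mulr_natr mulr2n ltrDl.
Qed.

Lemma fock_norm_le_partial (f : F2) (e : R) : 0 <= e ->
  (forall N, series (level (fun a => nrm (f a) ^+ 2)) N <= e ^+ 2) -> nrm f <= e.
Proof.
move=> e0 fe; rewrite nrm_fock -ler_sqr ?nnegrE ?sqrtr_ge0// fock_norm_sqr.
by apply: limr_le; [exact: fock_cvg|near=> N; exact: fe].
Unshelve. all: by end_near. Qed.

Lemma fock_partial_le (f : F2) N :
  series (level (fun a => nrm (f a) ^+ 2)) N <= nrm f ^+ 2.
Proof.
rewrite nrm_fock fock_norm_sqr.
apply: (level_partial_le (u := fun a => nrm (f a) ^+ 2)); last exact: fock_cvg.
by move=> a; rewrite sqr_ge0.
Qed.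

Lemma fock_cauchy_cvg (F : set_system F2) : ProperFilter F -> cauchy F -> cvg F.
Proof.
move=> FF Fc.
have cr := cauchy_fock_coef (p := @complex.Re R) _ _ FF Fc.
have ci := cauchy_fock_coef (p := @complex.Im R) _ _ FF Fc.
have {}cr a : cvg ((fun f : F2 => complex.Re (f a)) @ F).
  apply: cr => [[? ?] [? ?]//|[x y]].
  by rewrite /nrm normc_def/= -{1}sqrtr_sqr ler_wsqrtr// lerDl sqr_ge0.
have {}ci a : cvg ((fun f : F2 => complex.Im (f a)) @ F).
  apply: ci => [[? ?] [? ?]//|[x y]].
  by rewrite /nrm normc_def/= -{1}sqrtr_sqr ler_wsqrtr// lerDr sqr_ge0.
pose l : seq 'I_n -> R[i]^o := fun a => lim ((fun f : F2 => complex.Re (f a)) @ F) +i*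
    lim ((fun f : F2 => complex.Im (f a)) @ F).
have gl (e : R) (g : F2) : F [set h | nrm (g - h) <= e] -> forall N,
    series (level (fun a => nrm ((g a : R[i]^o) - l a) ^+ 2)) N <= e ^+ 2.
  move=> Fg N.
  pose phi (h : F2) := series (level (fun a => nrm ((g a : R[i]^o) - h a) ^+ 2)) N.
  have phil : phi @ F --> series (level (fun a => nrm ((g a : R[i]^o) - l a) ^+ 2)) N.
    rewrite /phi /series/= /level.
    apply: cvg_bigsum => k; apply: cvg_bigsum => a.
    rewrite (_ : (fun h : F2 => _) = (fun h : F2 =>
      (complex.Re (g a) - complex.Re (h a)) * (complex.Re (g a) - complex.Re (h a)) +
      (complex.Im (g a) - complex.Im (h a)) * (complex.Im (g a) - complex.Im (h a))));
      last by apply/funext => h; rewrite nrm_sqr; case: (g a) (h a) => [? ?] [? ?].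
    rewrite nrm_sqr (_ : complex.Re (_ - _) = complex.Re (g a) - complex.Re (l a)); last first.
      by case: (g a) (l a) => [? ?] [? ?].
    rewrite (_ : complex.Im (_ - _) = complex.Im (g a) - complex.Im (l a)); last first.
      by case: (g a) (l a) => [? ?] [? ?].
    have r : (fun h : F2 => complex.Re (g a) - complex.Re (h a)) @ F -->
      complex.Re (g a) - complex.Re (l a) := cvgB (cvg_cst (complex.Re (g a))) (cr a : _ --> complex.Re (l a)).
    have i : (fun h : F2 => complex.Im (g a) - complex.Im (h a)) @ F -->
      complex.Im (g a) - complex.Im (l a) := cvgB (cvg_cst (complex.Im (g a))) (ci a : _ --> complex.Im (l a)).
    by rewrite !expr2; apply: cvgD; apply: cvgM; do ?[exact: r|exact: i].
  apply: cvgr_to_le phil _; apply: filterS Fg => h gh.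
  rewrite (le_trans (fock_partial_le (g - h) N))// ler_sqr ?nnegrE ?nrm_ge0//.
  exact: le_trans (nrm_ge0 _) gh.
have [g Fg] := cauchy_fock_ex FF Fc ltr01.
have dP : (fun a => (g a : R[i]^o) - l a) \in @square_summable R n.
  apply/asboolP; apply: nondecreasing_is_cvgn.
    by apply: nondecreasing_series => k _ _; apply: level_ge0 => a; rewrite sqr_ge0.
  by exists (1 ^+ 2) => _ [N _ <-]; exact: gl.
pose l' : F2 := g - Fock dP.
have l'E a : l' a = l a by rewrite fock_coefB /= subKr.
apply/cvg_ex; exists l'; apply/fcvgrPdist_lt => e e0.
have eE : e = (complex.Re e)%:C by rewrite RRe_real// gtr0_real.
have e'0 : 0 < complex.Re e by rewrite -ltcR -eE.
have [h Fh] := cauchy_fock_ex FF Fc (divr_gt0 e'0 (ltr0Sn R 2)).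
have hl' : nrm (h - l') <= complex.Re e / 3.
  apply: fock_norm_le_partial => [|N]; first by rewrite ltW// divr_gt0.
  have -> : (fun a => nrm ((h - l') a) ^+ 2) =
            (fun a => nrm ((h a : R[i]^o) - l a) ^+ 2).
    by apply/funext => a; rewrite fock_coefB l'E.
  exact: gl.
apply: filterS Fh => h' hh'.
rewrite eE nrmE ltcR (_ : l' - h' = - (h - l') + (h - h')); last first.
  by rewrite opprB addrA subrK.
rewrite (le_lt_trans (nrmD _ _))// (_ : nrm (- _) = nrm (h - l')); last first.
  by rewrite /nrm normrN.
have /= := hh'; lra.
Qed.

HB.instance Definition _ := Uniform_isComplete.Build F2 fock_cauchy_cvg.

Lemma fock_dot_norm (f : F2) : fock_dot f f = `|f| ^+ 2.
Proof. by rewrite fock_dotE nrmE nrm_fock rmorphXn. Qed.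

HB.instance Definition _ := isHilbert.Build R F2 fock_dot_norm.

End fock_complete.

Section creation_operators.
Variables (R : realType) (n : nat).
Local Notation F2 := (fock R n).

Lemma fock_basis_summable (a : seq 'I_n) :
  (fun b : seq 'I_n => (b == a)%:R : R[i]^o) \in @square_summable R n.
Proof.
apply/asboolP; apply: nondecreasing_is_cvgn.
  by apply: nondecreasing_series => k _ _; apply: level_ge0 => b; exact: sqr_ge0.
exists 1 => _ [N _ <-].
have lE k : level (fun b => nrm ((b == a)%:R : R[i]^o) ^+ 2) k = (k == size a)%:R :> R.
  rewrite /level; have [kE|kN] := eqVneq k (size a).
    subst k; rewrite (bigD1 (in_tuple a))//= eqxx big1 => [|b ba].
      by rewrite addr0 /nrm normr1 expr1n.
    have /negPf -> : val b != a by apply: contra_neq ba => ba; exact: val_inj.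
    by rewrite [nrm _](@nrm0 R R[i]^o) expr0n.
  apply: big1 => b _; have /negPf -> : val b != a.
    by apply: contra_neq kN => <-; rewrite size_tuple.
  by rewrite [nrm _](@nrm0 R R[i]^o) expr0n.
have -> : series (level (fun b => nrm ((b == a)%:R : R[i]^o) ^+ 2)) N =
    (size a < N)%:R :> R.
  rewrite /series/=; elim: N => [|N IH]; first by rewrite big_geq.
  rewrite big_nat_recr//= IH lE ltnS [in RHS]leq_eqVlt (eq_sym N).
  by case: (ltngtP (size a) N) => _ /=; rewrite ?addr0 ?add0r.
by case: (_ < _)%N.
Qed.

Definition fock_basis (a : seq 'I_n) : F2 := Fock (fock_basis_summable a).

Definition creation_fun (i : 'I_n) (f : F2) (b : seq 'I_n) : R[i]^o :=
  if b is j :: b' then if j == i then f b' else 0 else 0.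

Lemma series_creation (i : 'I_n) (f : F2) N :
  series (level (fun b => nrm (creation_fun i f b) ^+ 2)) N.+1 =
  series (level (fun b => nrm (f b) ^+ 2)) N.
Proof.
have nrm00 : nrm (0 : R[i]^o) ^+ 2 = 0 by rewrite nrm0 expr0n.
rewrite /series/= big_nat_recl//= [level _ 0%N]big1 ?add0r => [|b _]; last first.
  by rewrite (tuple0 b)/= nrm00.
apply: eq_bigr => k _; rewrite /level.
rewrite (reindex (fun p : 'I_n * k.-tuple 'I_n => [tuple of p.1 :: p.2]))/=; last first.
  exists (fun t : k.+1.-tuple 'I_n => (thead t, [tuple of behead t])) => [[j b] _|t _].
    by congr (_, _); apply: val_inj.
  by rewrite [RHS]tuple_eta.
rewrite -(pair_bigA _ (fun j (b : k.-tuple 'I_n) =>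
  nrm (if j == i then f b else 0 : R[i]^o) ^+ 2))/= (bigD1 i)//= eqxx.
rewrite [X in _ + X]big1 ?addr0// => j /negPf ji.
by apply: big1 => b _; rewrite ji nrm00.
Qed.

Lemma creation_summable (i : 'I_n) (f : F2) :
  creation_fun i f \in @square_summable R n.
Proof.
apply/asboolP; apply: nondecreasing_is_cvgn.
  by apply: nondecreasing_series => k _ _; apply: level_ge0 => b; exact: sqr_ge0.
exists (nrm f ^+ 2) => _ [[|N] _ <-]; last first.
  by rewrite series_creation fock_partial_le.
by rewrite /series/= big_geq// sqr_ge0.
Qed.

Definition creation_fock (i : 'I_n) (f : F2) : F2 := Fock (creation_summable i f).

Lemma creation_bounded (i : 'I_n) : creation_fock i \in @bounded_linear R F2.
Proof.
apply/asboolP; split.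
  move=> c f g; apply: fockP => -[|j b]; rewrite /= /creation_fun.
    by change (0 = c * 0 + 0 :> R[i]); rewrite mulr0 addr0.
  case: (eqVneq j i) => [ji|ji].
    by change ((c *: f + g) b = c * (if j == i then f b else 0) + (if j == i then g b else 0) :> R[i]); rewrite ji eqxx.
  by change (0 = c * (if j == i then f b else 0) + (if j == i then g b else 0) :> R[i]); rewrite (negPf ji) mulr0 addr0.
exists 1 => f; rewrite mul1r; apply: fock_norm_le_partial; first exact: nrm_ge0.
move=> [|N]; first by rewrite /series/= big_geq// sqr_ge0.
by rewrite (series_creation i f N) fock_partial_le.
Qed.

Definition creation (i : 'I_n) : bop F2 := BOp (creation_bounded i).

Lemma creationE (i : 'I_n) (a : seq 'I_n) :
  creation i (fock_basis a) = fock_basis (i :: a).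
Proof.
apply: fockP => -[|j b] //=; rewrite eqseq_cons.
by case: (j == i).
Qed.

End creation_operators.

Section multi_operators.
Variables (R : realType) (n : nat) (H : hilbertType R).
Implicit Types (A B : bop H) (T : 'I_n -> bop H) (c : seq 'I_n -> R[i]).

(* The adjoint exists (Riesz) and is unique, so that the default value 0 is
   never used. *)
Definition adjoint A : bop H :=
  xget 0 [set B : bop H | forall x y, dotp (A x) y = dotp x (B y)].

Definition spectrum A : set R[i] :=
  [set z | ~ exists B : bop H,
    (z *: (1 : bop H) - A) * B = 1 /\ B * (z *: (1 : bop H) - A) = 1].

(* The spectrum is empty exactly when H = 0, where sup set0 = 0. *)
Definition spectral_radius A : R := sup [set nrm z | z in spectrum A].

Definition word_op T (a : seq 'I_n) : bop H := \prod_(i <- a) T i.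

Definition level_norm T (k : nat) : R :=
  nrm (\sum_(a : k.-tuple 'I_n) word_op T a * adjoint (word_op T a)).

Definition quasi_nilpotent T : Prop :=
  (fun k => level_norm T k `^ (2 * k%:R)^-1) @ \oo --> (0 : R).

(* A least upper bound in R: it is the true supremum as soon as the sequence is
   bounded, in particular for quasi-nilpotent tuples. *)
Definition power_bound T : R :=
  sup (range (fun k => Num.sqrt (level_norm T k))).

(* The limit is taken in bop H, that is, for the operator norm. *)
Definition fcalc c T : bop H :=
  limn (series (fun k => \sum_(a : k.-tuple 'I_n) c a *: word_op T a)).

(* Convergence of a sequence of operators in the weak, strong and w* operator
   topologies; the norm topology is that of bop H. The functionals
   A |-> \sum_j <A x_j, y_j>, for square-summable sequences x and y, are all
   the elements of the predual of bop H (the trace class). *)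
Definition wot_cvg (A_ : nat -> bop H) A : Prop :=
  forall x y : H,
    (fun k => dotp (A_ k x) y : R[i]^o) @ \oo --> (dotp (A x) y : R[i]^o).

Definition sot_cvg (A_ : nat -> bop H) A : Prop :=
  forall x : H, (fun k => A_ k x) @ \oo --> A x.

Definition wstar_functional (x y : nat -> H) A : R[i]^o :=
  limn (series (fun j => dotp (A (x j)) (y j) : R[i]^o)).

Definition wstar_cvg (A_ : nat -> bop H) A : Prop :=
  forall x y : nat -> H,
    cvgn (series (fun j => nrm (x j) ^+ 2)) ->
    cvgn (series (fun j => nrm (y j) ^+ 2)) ->
    (fun k => wstar_functional x y (A_ k)) @ \oo --> wstar_functional x y A.

End multi_operators.

(* Formal power series \sum_a c_a Z_a are given by their coefficients. *)
Definition hol0 (R : realType) (n : nat) (c : seq 'I_n -> R[i]) : Prop :=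
  (limn_esup (fun k => ((\sum_(a : k.-tuple 'I_n)
     nrm (c a) ^+ 2) `^ (2 * k%:R)^-1)%:E) < +oo)%E.

Definition weighted_multishift (R : realType) (n : nat)
    (W : 'I_n -> bop (fock R n)) : Prop :=
  exists mu : seq 'I_n -> R,
    [/\ forall a, 0 <= mu a,
        forall i, has_ubound (range (fun a => mu (i :: a))) &
        forall i a, W i (fock_basis R a) = (mu (i :: a))%:C *: fock_basis R (i :: a)].

Definition fock_polynomial (R : realType) (n : nat) (p : fock R n) : Prop :=
  exists (s : seq (seq 'I_n)) (d : seq 'I_n -> R[i]),
    p = \sum_(a <- s) d a *: fock_basis R a.

(* A is the bounded extension c(S_1, ..., S_n) of p |-> \sum_a c_a S_a p. *)
Definition creation_calc (R : realType) (n : nat) (c : seq 'I_n -> R[i])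
    (A : bop (fock R n)) : Prop :=
  forall p : fock R n, fock_polynomial p ->
    series (fun k => \sum_(a : k.-tuple 'I_n)
      c a *: word_op (@creation R n) a p) @ \oo --> A p.

(* Main.v *)
(** Let [t_k^2] be the norm of [\sum_(|a| = k) T_a T_a^*].  Take the radial shift
    [W_i e_a = w_|a| e_(ia)] whose weights decrease to [0] and dominate
    [2 t_(k+1)^(1/(k+1))], so that [b_k = w_0 ... w_(k-1) >= 2^k t_k] and
    [W_a e_0 = b_|a| e_a].  For [h, y] in [H] the functional
    [e_a |-> b_|a|^-1 <T_a h, y>] extends to the Fock space with norm at most
    [(\sum_k 4^-k)^(1/2) |h| |y|], where [\sum_k 4^-k = 4/3 <= pi^2/6] since
    [pi^2 >= 8].  If [eta h y] represents it, then
    [<f(T) h, y> = <f(W) e_0, eta h y>]: thus [f(T)] depends continuously on the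
    single vector [f(W) e_0], which gives the norm inequalities and the transfer
    of every mode of convergence.
    As for the spectral radii, for a quasi-nilpotent tuple the spectrum of [f(T)]
    is contained in [{f(0)}], and [f(0)] is in the spectrum of [f(W)]. *)

Require Import Defs.
From HB Require Import structures.
From mathcomp Require Import all_boot all_order all_algebra.
From mathcomp Require Import sesquilinear complex.
From mathcomp Require Import all_classical all_reals all_analysis.
From mathcomp Require Import ring lra.

Set Implicit Arguments.
Unset Strict Implicit.
Unset Printing Implicit Defensive.

Import Order.TTheory GRing.Theory Num.Theory.
Import numFieldNormedType.Exports.

Local Open Scope classical_set_scope.
Local Open Scope ring_scope.

Local Open Scope complex_scope.
Local Open Scope ring_scope.

(** * Norms with real values and complete spaces of operators *)

Section nrm.
Variable R : realType.

Lemma nrm_eqR (V : normedZmodType R[i]) (x : V) (r : R) :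
  `|x| = r%:C -> nrm x = r.
Proof. by rewrite /nrm => ->. Qed.

Lemma nrmN (V : normedZmodType R[i]) (x : V) : nrm (- x) = nrm x.
Proof. by rewrite /nrm normrN. Qed.

Lemma nrmB (V : normedZmodType R[i]) (x y : V) : nrm (x - y) = nrm (y - x).
Proof. by rewrite /nrm distrC. Qed.

Lemma ler_nrm_sum (V : normedZmodType R[i]) (I : Type) (r : seq I) (P : pred I)
  (F : I -> V) : nrm (\sum_(i <- r | P i) F i) <= \sum_(i <- r | P i) nrm (F i).
Proof.
elim/big_ind2 : _ => [|x a y b xa yb|//]; first by rewrite nrm0.
by rewrite (le_trans (nrmD _ _))// lerD.
Qed.

Lemma nrm_le_dist (V : normedZmodType R[i]) (x y : V) :
  nrm x <= nrm y + nrm (x - y).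
Proof. by rewrite -{1}(subrK y x) addrC (le_trans (nrmD _ _)). Qed.

Lemma nrmM (a b : R[i]) : nrm (a * b) = nrm a * nrm b.
Proof. by apply: nrm_eqR; rewrite normrM !nrmE rmorphM. Qed.

Lemma nrm_conj (a : R[i]) : nrm a^* = nrm a.
Proof. by rewrite /nrm norm_conjC. Qed.

Lemma nrm_real (r : R) : nrm r%:C = `|r|.
Proof. by apply: nrm_eqR; rewrite normc_def/= expr0n addr0 sqrtr_sqr. Qed.

Lemma conj_real (r : R) : (r%:C : R[i])^* = r%:C.
Proof. exact: conjc_real. Qed.

Lemma conj_realM (r : R) (z : R[i]) : (r%:C * z)^* = r%:C * z^*.
Proof. by rewrite rmorphM [X in X * _]conj_real. Qed.

Lemma nrm_gt0 (V : normedZmodType R[i]) (x : V) : (0 < nrm x) = (x != 0).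
Proof.
rewrite lt_def nrm_ge0 andbT; congr (~~ _); apply/eqP/eqP => [/nrm0_eq0//|->].
exact: nrm0.
Qed.

Lemma mul_conj_nrm (a : R[i]) : a * a^* = (nrm a ^+ 2)%:C.
Proof. by rewrite -normCK nrmE rmorphXn. Qed.

Lemma normr_Re_le (a : R[i]) : `|complex.Re a| <= nrm a.
Proof.
case: a => x y; rewrite /nrm normc_def/= -sqrtr_sqr ler_wsqrtr// lerDl.
exact: sqr_ge0.
Qed.

Lemma Re_le_nrm (a : R[i]) : complex.Re a <= nrm a.
Proof. by rewrite (le_trans (ler_norm _))// normr_Re_le. Qed.

(** A positive element of [R[i]] is real, so the [R[i]]-valued radii of the topology can be
    exchanged for radii in [R]. *)
Lemma cvg_nrmP (V : normedModType R[i]) (u : nat -> V) (l : V) :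
  u @ \oo --> l <-> (fun k => nrm (u k - l)) @ \oo --> (0 : R).
Proof.
split=> [/cvgrPdist_le ul|/cvgrPdist_le ul]; apply/cvgrPdist_le => e e0.
  have eC : 0 < e%:C by rewrite ltcR.
  apply: filterS (ul _ eC) => k.
  by rewrite sub0r normrN ger0_norm ?nrm_ge0// distrC nrmE lecR.
have eE : e = (complex.Re e)%:C by rewrite RRe_real// gtr0_real.
have e'0 : 0 < complex.Re e by rewrite -ltcR -eE.
apply: filterS (ul _ e'0) => k.
by rewrite sub0r normrN ger0_norm ?nrm_ge0// distrC nrmE [in X in _ -> X]eE lecR.
Qed.

Lemma cvg_nrm (V : normedModType R[i]) (u : nat -> V) (l : V) :
  u @ \oo --> l -> (fun k => nrm (u k)) @ \oo --> nrm l.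
Proof.
move=> /cvg_nrmP ul; apply/cvgrPdist_le => e e0.
move/cvgrPdist_le : ul => /(_ _ e0); apply: filterS => k.
rewrite sub0r normrN ger0_norm ?nrm_ge0// => le.
rewrite ler_norml; apply/andP; split.
  by have := nrm_le_dist (u k) l; lra.
by have := nrm_le_dist l (u k); rewrite (nrmB l); lra.
Qed.

Lemma cvg_nrm_le (V W : normedModType R[i]) (u : nat -> V) (l : V)
  (v : nat -> W) (m : W) (C : R) : (forall k, nrm (v k - m) <= C * nrm (u k - l)) ->
  u @ \oo --> l -> v @ \oo --> m.
Proof.
move=> uv /cvg_nrmP ul; apply/cvg_nrmP.
have Cul : (fun k => C * nrm (u k - l)) @ \oo --> (0 : R).
  by rewrite -(mulr0 C); apply: cvgM => //; exact: cvg_cst.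
apply: squeeze_cvgr (@cvg_cst _ _ _ _ _) Cul.
by apply: nearW => k; rewrite nrm_ge0 uv.
Qed.

Lemma cvg_Re (u : nat -> R[i]^o) (l : R[i]^o) :
  u @ \oo --> l -> (fun k => complex.Re (u k)) @ \oo --> complex.Re l.
Proof.
move=> /cvg_nrmP ul; apply/cvgrPdist_le => e e0.
move/cvgrPdist_le : ul => /(_ _ e0); apply: filterS => k.
rewrite sub0r normrN ger0_norm ?nrm_ge0// nrmB => /(le_trans _); apply.
by apply: le_trans (normr_Re_le _); rewrite raddfB.
Qed.

Lemma nrm_cvg_le (V : normedModType R[i]) (u : nat -> V) (l : V) (M : R) :
  u @ \oo --> l -> (\forall k \near \oo, nrm (u k) <= M) -> nrm l <= M.
Proof. by move=> /cvg_nrm ul; exact: cvgr_to_le. Qed.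

Lemma cvgn_unique (V : normedModType R[i]) (u : nat -> V) (l m : V) :
  u @ \oo --> l -> u @ \oo --> m -> l = m.
Proof. by move=> ul um; apply: (cvg_unique _ ul um); exact: norm_hausdorff. Qed.

Lemma nrm_cauchy_cvg (V : completeNormedModType R[i]) (u : nat -> V) :
  (forall e : R, 0 < e ->
    exists N, forall j k, (N <= j)%N -> (N <= k)%N -> nrm (u j - u k) <= e) ->
  cvgn u.
Proof.
move=> uc; apply/cauchy_cvgP/cauchy_exP => e e0.
have eE : e = (complex.Re e)%:C by rewrite RRe_real// gtr0_real.
have e'0 : 0 < complex.Re e by rewrite -ltcR -eE.
have [N uN] := uc _ (divr_gt0 e'0 (ltr0Sn R 1)).
exists (u N); exists N => // k /= Nk.
rewrite -ball_normE /= eE nrmE ltcR (le_lt_trans (uN _ _ (leqnn N) Nk))//.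
by rewrite ltr_pdivrMr// ltr_pMr// ltr1n.
Qed.

Lemma nrm_series_cauchy (V : normedModType R[i]) (u : nat -> V) (v : nat -> R) :
  (forall k, nrm (u k) <= v k) -> cvgn (series v) ->
  forall e : R, 0 < e -> exists N, forall j k, (N <= j)%N -> (N <= k)%N ->
    nrm (series u j - series u k) <= e.
Proof.
move=> uv /cvg_ex[l /cvgrPdist_le vl] e e0.
have [N _ vN] := vl _ (divr_gt0 e0 (ltr0Sn R 1)).
have key i j : (N <= i)%N -> (i <= j)%N -> nrm (series u j - series u i) <= e.
  move=> Ni ij; rewrite sub_series_geq//.
  apply: (@le_trans _ _ (series v j - series v i)).
    by rewrite sub_series_geq// (le_trans (ler_nrm_sum _ _ _))// ler_sum.
  have := vN _ Ni; have := vN _ (leq_trans Ni ij); rewrite !ler_norml /=; lra.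
exists N => j k Nj Nk; have [jk|/ltnW kj] := leqP j k; last exact: key.
by rewrite nrmB; exact: key.
Qed.

End nrm.

Section bop_complete.
Variables (R : realType) (V : completeNormedModType R[i]).

(** The pointwise limit exists because [V] is complete; the Cauchy estimate passes to it uniformly
    on the unit ball, which makes it bounded and a limit in norm. *)
Lemma bop_cauchy_cvg (A : nat -> bop V) :
  (forall e : R, 0 < e ->
    exists N, forall j k, (N <= j)%N -> (N <= k)%N -> nrm (A j - A k) <= e) ->
  cvgn A.
Proof.
move=> Ac.
have AB j k x : nrm (A j x - A k x) <= nrm (A j - A k) * nrm x.
  by have := le_opnorm (A j - A k) x.
have Ax x : cvgn (fun k => A k x).
  apply: nrm_cauchy_cvg => e e0.
  have x1 : 0 < nrm x + 1 by rewrite ltr_wpDl ?nrm_ge0.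
  have [N AN] := Ac _ (divr_gt0 e0 x1); exists N => j k Nj Nk.
  rewrite (le_trans (AB _ _ _))// (le_trans (ler_wpM2r (nrm_ge0 x) (AN _ _ Nj Nk)))//.
  by rewrite -mulrA ler_piMr ?(ltW e0)// mulrC ler_pdivrMr// mul1r lerDl.
pose L x := limn (fun k => A k x).
have AL x : (fun k => A k x) @ \oo --> L x by exact: Ax.
(* The rank [N] does not depend on [x]: this uniformity upgrades pointwise to norm convergence. *)
have Alim e N : (forall j k, (N <= j)%N -> (N <= k)%N -> nrm (A j - A k) <= e) ->
    forall k x, (N <= k)%N -> nrm (A k x - L x) <= e * nrm x.
  move=> AN k x Nk; apply: (@nrm_cvg_le _ _ (fun j => A k x - A j x)).
    by apply: cvgB => //; exact: cvg_cst.
  exists N => // j /= Nj; rewrite (le_trans (AB _ _ _))//.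
  by rewrite ler_wpM2r ?nrm_ge0// AN.
have LP : L \in @bounded_linear R V.
  apply/asboolP; split.
    move=> a x y; apply: (cvgn_unique (AL _)).
    rewrite (_ : (fun k => _) = (fun k => a *: A k x + A k y)).
      by apply: cvgD => //; apply: cvgZr.
    by apply/funext => k; rewrite linearP.
  have [N AN] := Ac 1 ltr01; exists (1 + nrm (A N)) => x.
  have := nrm_le_dist (L x) (A N x); rewrite nrmB => /le_trans; apply.
  by rewrite addrC mulrDl lerD ?le_opnorm// (Alim _ N).
apply/cvg_ex; exists (BOp LP); apply/cvg_nrmP/cvgrPdist_le => e e0.
have [N AN] := Ac _ e0; exists N => // k /= Nk.
rewrite sub0r normrN ger0_norm ?nrm_ge0// nrm_opnorm.
by apply: opnorm_le => [|x]; [exact: ltW|exact: (Alim _ N)].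
Qed.

Lemma bop_series_cvg (A : nat -> bop V) (v : nat -> R) :
  (forall k, nrm (A k) <= v k) -> cvgn (series v) -> cvgn (series A).
Proof. by move=> Av cv; apply: bop_cauchy_cvg; exact: nrm_series_cauchy cv. Qed.

Lemma vec_series_cvg (x : nat -> V) (v : nat -> R) :
  (forall k, nrm (x k) <= v k) -> cvgn (series v) -> cvgn (series x).
Proof. by move=> xv cv; apply: nrm_cauchy_cvg; exact: nrm_series_cauchy cv. Qed.

End bop_complete.

Section bop_ring.
Variables (R : realType) (V : normedModType R[i]).
Implicit Types (A B : bop V) (x : V).

Lemma nrm_bop A x : nrm (A x) <= nrm A * nrm x.
Proof. exact: le_opnorm. Qed.

Lemma nrm_bop_le A (M : R) : 0 <= M ->
  (forall x, nrm (A x) <= M * nrm x) -> nrm A <= M.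
Proof. exact: opnorm_le. Qed.

Lemma bopM A B x : (A * B) x = A (B x). Proof. by []. Qed.
Lemma bopB A B x : (A - B) x = A x - B x. Proof. by []. Qed.
Lemma bopZ a A x : (a *: A) x = a *: A x. Proof. by []. Qed.
Lemma bop1 x : (1 : bop V) x = x. Proof. by []. Qed.

Lemma bop_sum (I : Type) (r : seq I) (P : pred I) (F : I -> bop V) x :
  (\sum_(i <- r | P i) F i) x = \sum_(i <- r | P i) F i x.
Proof. by elim/big_rec2 : _ => [|i y B _ <-]. Qed.

Lemma nrm_bopM A B : nrm (A * B) <= nrm A * nrm B.
Proof.
apply: nrm_bop_le => [|x]; first by rewrite mulr_ge0 ?nrm_ge0.
rewrite bopM (le_trans (nrm_bop _ _))// -mulrA ler_wpM2l ?nrm_ge0//.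
exact: nrm_bop.
Qed.

Lemma nrm_bop1 : nrm (1 : bop V) <= 1.
Proof. by apply: nrm_bop_le => // x; rewrite mul1r. Qed.

Lemma cvg_bop (A_ : nat -> bop V) A x :
  A_ @ \oo --> A -> (fun k => A_ k x) @ \oo --> A x.
Proof.
apply: (@cvg_nrm_le _ _ _ _ _ _ _ (nrm x)) => k.
by rewrite -bopB mulrC nrm_bop.
Qed.

Lemma cvg_bopMl (A_ : nat -> bop V) A B :
  A_ @ \oo --> A -> (fun k => B * A_ k) @ \oo --> B * A.
Proof.
by apply: (@cvg_nrm_le _ _ _ _ _ _ _ (nrm B)) => k; rewrite -mulrBr nrm_bopM.
Qed.

Lemma cvg_bopMr (A_ : nat -> bop V) A B :
  A_ @ \oo --> A -> (fun k => A_ k * B) @ \oo --> A * B.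
Proof.
apply: (@cvg_nrm_le _ _ _ _ _ _ _ (nrm B)) => k.
by rewrite -mulrBl (le_trans (nrm_bopM _ _))// mulrC.
Qed.

Lemma bop_scaleMl a A B : (a *: A) * B = a *: (A * B).
Proof. exact: bopP. Qed.

Lemma bop_scaleMr a A B : A * (a *: B) = a *: (A * B).
Proof. by apply: bopP => x; rewrite /= linearZ. Qed.

End bop_ring.

(** * Riesz representation and row bounds for words *)

(** Cauchy-Schwarz by induction on the list. With [p], [q] the square roots of the two remaining
    sums, the new cross term is handled by [(|a_i| q - p |b_i|)^2 >= 0]. *)
Lemma sqr_sum_mul_le (R : realType) (I : Type) (r : seq I) (a b : I -> R) :
  (\sum_(i <- r) a i * b i) ^+ 2 <=
  (\sum_(i <- r) a i ^+ 2) * (\sum_(i <- r) b i ^+ 2).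
Proof.
elim: r => [|i r IH]; first by rewrite !big_nil expr0n mulr0.
rewrite !big_cons.
have A0 : 0 <= \sum_(j <- r) a j ^+ 2 by rewrite sumr_ge0// => j _; exact: sqr_ge0.
have B0 : 0 <= \sum_(j <- r) b j ^+ 2 by rewrite sumr_ge0// => j _; exact: sqr_ge0.
move: (\sum_(j <- r) a j * b j) (\sum_(j <- r) a j ^+ 2) (\sum_(j <- r) b j ^+ 2)
  IH A0 B0 => s A B sAB A0 B0.
suff : 2 * (a i * b i) * s <= a i ^+ 2 * B + A * b i ^+ 2 by nra.
have [p p0 pE] : exists2 p, 0 <= p & p ^+ 2 = A.
  by exists (Num.sqrt A); rewrite ?sqrtr_ge0 ?sqr_sqrtr.
have [q q0 qE] : exists2 q, 0 <= q & q ^+ 2 = B.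
  by exists (Num.sqrt B); rewrite ?sqrtr_ge0 ?sqr_sqrtr.
have sle : `|s| <= p * q.
  rewrite -ler_sqr ?nnegrE ?mulr_ge0//.
  by rewrite real_normK ?num_real// exprMn pE qE.
have : 2 * (a i * b i) * s <= 2 * (`|a i| * `|b i|) * (p * q).
  rewrite (le_trans (ler_norm _))// !normrM ger0_norm//.
  by rewrite ler_wpM2l ?mulr_ge0.
move/le_trans; apply; rewrite -pE -qE -subr_ge0.
rewrite -(real_normK (num_real (a i))) -(real_normK (num_real (b i))).
rewrite (_ : _ - _ = (`|a i| * q - p * `|b i|) ^+ 2); last by ring.
exact: sqr_ge0.
Qed.

Section hilbert.
Variables (R : realType) (H : hilbertType R).
Implicit Types (x y z : H) (A B : bop H).

Lemma dotpDl x y z : dotp (x + y) z = dotp x z + dotp y z.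
Proof. exact: linearDl. Qed.
Lemma dotpDr x y z : dotp z (x + y) = dotp z x + dotp z y.
Proof. exact: linearDr. Qed.
Lemma dotpBl x y z : dotp (x - y) z = dotp x z - dotp y z.
Proof. exact: linearBl. Qed.
Lemma dotpBr x y z : dotp z (x - y) = dotp z x - dotp z y.
Proof. exact: linearBr. Qed.
Lemma dotpZl a x z : dotp (a *: x) z = a * dotp x z.
Proof. exact: linearZl_LR. Qed.
Lemma dotpZr a x z : dotp z (a *: x) = a^* * dotp z x.
Proof. exact: linearZr_LR. Qed.
Lemma dotpC x y : dotp x y = (dotp y x)^*.
Proof. by rewrite (hermC dotp) expr0 mul1r. Qed.

Lemma dotp_suml (I : Type) (r : seq I) (P : pred I) (F : I -> H) z :
  dotp (\sum_(i <- r | P i) F i) z = \sum_(i <- r | P i) dotp (F i) z.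
Proof. by elim/big_rec2 : _ => [|i u v _ <-]; [exact: linear0l|rewrite dotpDl]. Qed.

Lemma dotp_self x : dotp x x = (nrm x ^+ 2)%:C.
Proof. by rewrite dotp_norm nrmE rmorphXn. Qed.

Lemma nrm_sqrE x : nrm x ^+ 2 = complex.Re (dotp x x).
Proof. by rewrite dotp_self. Qed.

Lemma nrm_sqrD x y :
  nrm (x + y) ^+ 2 = nrm x ^+ 2 + nrm y ^+ 2 + 2 * complex.Re (dotp x y).
Proof.
rewrite !nrm_sqrE dotpDl !dotpDr (dotpC y x).
by case: (dotp x x) (dotp x y) (dotp y y) => [a ?] [b ?] [c ?] /=; ring.
Qed.

Lemma dotp_le x y : nrm (dotp x y) <= nrm x * nrm y.
Proof.
have [->|y0] := eqVneq y 0; first by rewrite (linear0r dotp) !nrm0 mulr0.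
have Y0 : 0 < nrm y by rewrite nrm_gt0.
rewrite -ler_sqr ?nnegrE ?mulr_ge0 ?nrm_ge0// exprMn.
rewrite -(ler_pM2l (exprn_gt0 2 Y0)) -subr_ge0.
(* The squared norm of [|y|^2 x - <x, y> y] is nonnegative; this multiple of the component of [x]
   orthogonal to [y] avoids division. *)
have := sqr_ge0 (nrm ((nrm y ^+ 2)%:C *: x + (- dotp x y) *: y)).
rewrite nrm_sqrD !nrmZ nrmN nrm_real ger0_norm ?sqr_ge0// dotpZl dotpZr.
rewrite (_ : complex.Re _ = - (nrm y ^+ 2 * nrm (dotp x y) ^+ 2)); first by nra.
rewrite rmorphN/= mulNr (mulrC _^*) mul_conj_nrm.
by rewrite mulrN -rmorphM -rmorphN.
Qed.

Lemma Re_dotp_le x y : complex.Re (dotp x y) <= nrm x * nrm y.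
Proof. by rewrite (le_trans (Re_le_nrm _))// dotp_le. Qed.

Lemma parallelogram x y :
  nrm (x - y) ^+ 2 = 2 * nrm x ^+ 2 + 2 * nrm y ^+ 2 - nrm (x + y) ^+ 2.
Proof.
rewrite !nrm_sqrD nrmN -scaleN1r dotpZr rmorphN rmorph1 mulN1r.
by case: (dotp x y) => a b /=; ring.
Qed.

Lemma dotp_inj y z : (forall x, dotp x y = dotp x z) -> y = z.
Proof.
move=> yz; apply/eqP; rewrite -subr_eq0; apply/eqP/nrm0_eq0/eqP.
by rewrite -sqrf_eq0 nrm_sqrE dotpBr yz subrr.
Qed.

Lemma cvg_dotpl (u : nat -> H) x y :
  u @ \oo --> x -> (fun k => dotp (u k) y : R[i]^o) @ \oo --> (dotp x y : R[i]^o).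
Proof.
apply: (@cvg_nrm_le _ _ _ _ _ _ _ (nrm y)) => k.
rewrite mulrC (le_trans _ (dotp_le _ _))//.
by rewrite dotpBl.
Qed.

Lemma cvg_dotpr (u : nat -> H) x y :
  u @ \oo --> x -> (fun k => dotp y (u k) : R[i]^o) @ \oo --> (dotp y x : R[i]^o).
Proof.
apply: (@cvg_nrm_le _ _ _ _ _ _ _ (nrm y)) => k.
by rewrite (le_trans _ (dotp_le _ _))// dotpBr.
Qed.

(* phi is represented by the minimizer of |x|^2 - 2 Re (phi x). *)
Lemma riesz (phi : H -> R[i]) (M : R) :
  (forall a x y, phi (a *: x + y) = a * phi x + phi y) ->
  (forall x, nrm (phi x) <= M * nrm x) ->
  exists z, forall x, phi x = dotp x z.
Proof.
move=> phiP phiM.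
have phi0 : phi 0 = 0.
  have := phiP (-1) 0 0; rewrite scaler0 addr0 mulN1r => ->.
  by rewrite addNr.
have phiD x y : phi (x + y) = phi x + phi y.
  by have := phiP 1 x y; rewrite scale1r mul1r.
have phiZ a x : phi (a *: x) = a * phi x.
  by have := phiP a x 0; rewrite !addr0 phi0 addr0.
pose J x := nrm x ^+ 2 - 2 * complex.Re (phi x).
have JM x : - M ^+ 2 <= J x.
  have := phiM x; have := Re_le_nrm (phi x); have := sqr_ge0 (nrm x - M).
  rewrite /J; nra.
have Jinf : has_inf (range J).
  split; first by exists (J 0), 0.
  by exists (- M ^+ 2) => _ [x _ <-].
have [m mE] : exists m : R, inf (range J) = m by eexists.
have Jm x : m <= J x by rewrite -mE; apply: ge_inf; [exact: Jinf.2|exists x].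
have /choice[u Ju] : forall k : nat, exists x, J x <= m + k.+1%:R^-1.
  move=> k; have k0 : (0 : R) < k.+1%:R^-1 by rewrite invr_gt0.
  by have [_ [x _ <-] /ltW] := inf_adherent k0 Jinf; rewrite mE; exists x.
have half x y : J ((2^-1 : R)%:C *: (x + y)) =
    nrm (x + y) ^+ 2 / 4 - complex.Re (phi x) - complex.Re (phi y).
  rewrite /J nrmZ phiZ phiD nrm_real ger0_norm ?invr_ge0//.
  by case: (phi x) (phi y) => [a ?] [b ?] /=; field.
(* The midpoint has [J] at least [m], so by the parallelogram law two near-minimizers are close; a
   minimizing sequence is therefore Cauchy. *)
have uc x y : nrm (x - y) ^+ 2 <= 2 * (J x - m) + 2 * (J y - m).
  have := Jm ((2^-1 : R)%:C *: (x + y)); rewrite half parallelogram /J; lra.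
have /cvg_ex[z uz] : cvgn u.
  apply: nrm_cauchy_cvg => e e0.
  have e2 : 0 < e ^+ 2 / 4 by rewrite divr_gt0// exprn_gt0.
  have [N _ NP] := near_infty_natSinv_lt (PosNum e2).
  exists N => j k Nj Nk; rewrite -ler_sqr ?nnegrE ?nrm_ge0 ?(ltW e0)//.
  have := uc (u j) (u k); have := Ju j; have := Ju k.
  have jN : (j.+1%:R^-1 : R) < e ^+ 2 / 4 := NP _ Nj.
  have kN : (k.+1%:R^-1 : R) < e ^+ 2 / 4 := NP _ Nk.
  move: (j.+1%:R^-1) (k.+1%:R^-1) jN kN (J (u j)) (J (u k)) => r s rN sN p q; lra.
exists z => x.
(* First variation at the minimizer: compare [J (h + u k) >= m] with [J (u k) <= m + 1/(k+1)] and
   let [k] tend to infinity. *)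
have var (h : H) : 0 <= nrm h ^+ 2 + 2 * (complex.Re (dotp h z) - complex.Re (phi h)).
  have cv : (fun k => nrm h ^+ 2 + 2 * (complex.Re (dotp h (u k)) - complex.Re (phi h))
      + k.+1%:R^-1) @ \oo -->
      nrm h ^+ 2 + 2 * (complex.Re (dotp h z) - complex.Re (phi h)) + 0.
    apply: cvgD; last exact: cvg_harmonic.
    apply: cvgD; first exact: cvg_cst.
    apply: cvgM; first exact: cvg_cst.
    apply: cvgB; last exact: cvg_cst.
    exact: cvg_Re (cvg_dotpr uz).
  rewrite -[leRHS]addr0; apply: cvgr_to_ge cv _; apply: nearW => k.
  have := Ju k; have := Jm (h + u k); rewrite /J nrm_sqrD phiD.
  case: (dotp h (u k)) (phi h) (phi (u k)) => [? ?] [? ?] [? ?] /=.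
  move: (k.+1%:R^-1) => r; lra.
pose psi := dotp x z - phi x.
(* The direction [h = - s psi^* x] aligns the phase, so that the linear term becomes
   [- 2 s |psi|^2]. *)
have varx (s : R) : 0 <= s ^+ 2 * nrm psi ^+ 2 * nrm x ^+ 2 - 2 * s * nrm psi ^+ 2.
  have := var ((- s%:C * psi^*) *: x); rewrite nrmZ nrmM nrmN nrm_conj nrm_real.
  rewrite dotpZl phiZ (_ : complex.Re _ - _ = - s * nrm psi ^+ 2).
    by rewrite !exprMn real_normK ?num_real//; lra.
  rewrite (_ : complex.Re _ - _ = complex.Re (- s%:C * (psi * psi^*))).
    by rewrite mul_conj_nrm -rmorphN -rmorphM.
  rewrite (mulrC psi) mulrA /psi mulrBr.
  by case: (_ * dotp x z) (_ * phi x) => [? ?] [? ?].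
apply/eqP; rewrite eq_sym -subr_eq0 -/psi; apply/eqP/nrm0_eq0/eqP.
rewrite -sqrf_eq0 eq_le sqr_ge0 andbT.
have x1 : 0 < nrm x ^+ 2 + 1 by rewrite ltr_wpDl ?sqr_ge0.
(* For this [s] the right-hand side is a positive multiple of [- (|x|^2 + 2) |psi|^2], which forces
   [psi = 0]. *)
have := varx (nrm x ^+ 2 + 1)^-1.
rewrite -(pmulr_rge0 _ (exprn_gt0 2 x1)).
set p := nrm x ^+ 2 in x1 *; set q := nrm psi ^+ 2.
have -> : (p + 1) ^+ 2 * ((p + 1)^-1 ^+ 2 * q * p - 2 * (p + 1)^-1 * q) =
  - (p + 2) * q by field; rewrite gt_eqF.
have p0 : 0 <= p by rewrite sqr_ge0.
by rewrite mulNr oppr_ge0 pmulr_rle0// ltr_wpDl.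
Qed.

(** Riesz applied to [x |-> <A x, y>] defines [B y]; linearity follows from uniqueness, and the
    bound from [|B y|^2 = <A (B y), y>]. So [xget] does pick an adjoint. *)
Lemma adjointP A x y : dotp (A x) y = dotp x (adjoint A y).
Proof.
suff [B BP] : exists B : bop H, forall x y, dotp (A x) y = dotp x (B y).
  by rewrite /adjoint; case: xgetP => [_ ->|/(_ B)]; [exact|case].
have /choice[B BP] y' : exists z, forall x, dotp (A x) y' = dotp x z.
  apply: (@riesz _ (nrm A * nrm y')) => [a u v|u]; first by rewrite linearP dotpDl dotpZl.
  by rewrite (le_trans (dotp_le _ _))// mulrAC ler_wpM2r ?nrm_ge0 ?nrm_bop.
have bP : B \in @bounded_linear R H.
  apply/asboolP; split=> [a u v|].
    by apply: dotp_inj => w; rewrite -BP dotpDr dotpZr [RHS]dotpDr dotpZr -!BP.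
  exists (nrm A) => v; have [->|Bv0] := eqVneq (B v) 0.
    by rewrite nrm0 mulr_ge0 ?nrm_ge0.
  rewrite -(ler_pM2l (_ : 0 < nrm (B v))) ?nrm_gt0// -expr2 nrm_sqrE -BP.
  rewrite (le_trans (Re_dotp_le _ _))// mulrA ler_wpM2r ?nrm_ge0//.
  by rewrite mulrC nrm_bop.
by exists (BOp bP).
Qed.

End hilbert.

(** * Words in a tuple: estimates by the row norm *)

Section words.
Variables (R : realType) (n : nat) (H : hilbertType R) (T : 'I_n -> bop H).

Lemma level_norm_ge0 k : 0 <= level_norm T k.
Proof. exact: nrm_ge0. Qed.

Lemma word_op_cat a b : word_op T (a ++ b) = word_op T a * word_op T b.
Proof. by rewrite /word_op big_cat. Qed.

Lemma level_bessel k h y :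
  \sum_(a : k.-tuple 'I_n) nrm (dotp (word_op T a h) y) ^+ 2 <=
  level_norm T k * nrm h ^+ 2 * nrm y ^+ 2.
Proof.
apply: (@le_trans _ _ (\sum_(a : k.-tuple 'I_n) nrm h ^+ 2 *
    complex.Re (dotp ((word_op T a * adjoint (word_op T a)) y) y))).
  apply: ler_sum => a _; rewrite bopM (adjointP _ h) (adjointP _ (adjoint _ y)).
  rewrite -nrm_sqrE -exprMn.
  by rewrite ler_sqr ?nnegrE ?mulr_ge0 ?nrm_ge0// dotp_le.
rewrite -mulr_sumr -(raddf_sum (@complex.Re R)) -dotp_suml -bop_sum.
rewrite [leRHS]mulrAC mulrC ler_wpM2r ?sqr_ge0//.
rewrite (le_trans (Re_dotp_le _ _))// expr2 mulrA ler_wpM2r ?nrm_ge0//.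
exact: nrm_bop.
Qed.

(** With [S] the sum, expand [<S h, S h>] along words, then apply Cauchy-Schwarz to the coefficients
    and [level_bessel] with [y = S h]. The words of one length are estimated jointly rather than one
    by one. *)
Lemma nrm_word_sum k (c : seq 'I_n -> R[i]) :
  nrm (\sum_(a : k.-tuple 'I_n) c a *: word_op T a) ^+ 2 <=
  level_norm T k * \sum_(a : k.-tuple 'I_n) nrm (c a) ^+ 2.
Proof.
set S := \sum_a _; set Cc := \sum_(a : _) nrm _ ^+ 2.
have C0 : 0 <= Cc by rewrite sumr_ge0// => a _; exact: sqr_ge0.
have LC : 0 <= level_norm T k * Cc by rewrite mulr_ge0 ?level_norm_ge0.
rewrite -[leRHS]sqr_sqrtr// ler_sqr ?nnegrE ?nrm_ge0 ?sqrtr_ge0//.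
apply: nrm_bop_le => [|h]; first exact: sqrtr_ge0.
have [->|v0] := eqVneq (S h) 0; first by rewrite nrm0 mulr_ge0 ?sqrtr_ge0 ?nrm_ge0.
have V0 : 0 < nrm (S h) by rewrite nrm_gt0.
rewrite -(ler_pM2l V0) -ler_sqr ?nnegrE ?mulr_ge0 ?nrm_ge0 ?sqrtr_ge0//.
rewrite [leRHS](_ : _ = Cc * (level_norm T k * nrm h ^+ 2 * nrm (S h) ^+ 2)); last first.
  by rewrite !exprMn sqr_sqrtr//; ring.
apply: le_trans (ler_wpM2l C0 (level_bessel _ _ _)).
apply: le_trans (sqr_sum_mul_le _ _ _).
rewrite -expr2 ler_sqr ?nnegrE ?sqr_ge0 ?sumr_ge0//; last first.
  by move=> a _; rewrite mulr_ge0 ?nrm_ge0.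
rewrite nrm_sqrE (le_trans (Re_le_nrm _))// {1}/S bop_sum dotp_suml.
rewrite (le_trans (ler_nrm_sum _ _ _))// ler_sum// => a _.
by rewrite bopZ dotpZl nrmM.
Qed.

End words.

(** * Convergence of the functional calculus *)

Lemma powR_root (R : realType) (s : R) (k : nat) : 0 <= s -> (0 < k)%N ->
  (s `^ (2 * k%:R)^-1) ^+ (2 * k) = s.
Proof.
move=> s0 k0; rewrite -powR_mulrn ?powR_ge0// -powRrM natrM mulVf ?powRr1//.
by rewrite mulf_neq0// pnatr_eq0 -lt0n.
Qed.

(** The finitely many ratios [s i / v i] before the threshold are absorbed into [C]. *)
Lemma near_le_bound (R : realType) (s v : nat -> R) :
  (forall k, 0 < v k) -> (\forall k \near \oo, s k <= v k) ->
  exists2 C, 1 <= C & forall k, s k <= C * v k.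
Proof.
move=> v0 [N _ sv].
have p0 i : 0 <= `|s i / v i| by [].
have S0 : 0 <= \sum_(i < N) `|s i / v i| by rewrite sumr_ge0.
exists (1 + \sum_(i < N) `|s i / v i|) => [|k]; first by rewrite lerDl.
have [kN|Nk] := ltnP k N; last first.
  by rewrite (le_trans (sv _ Nk))// ler_peMl ?(ltW (v0 k))// lerDl.
rewrite -ler_pdivrMr// (le_trans (ler_norm _))// (bigD1 (Ordinal kN))//= addrCA.
by rewrite lerDl addr_ge0// sumr_ge0.
Qed.

Section growth.
Variables (R : realType) (n : nat).

Definition geometric_growth (c : seq 'I_n -> R[i]) (M r : R) : Prop :=
  forall k, \sum_(a : k.-tuple 'I_n) nrm (c a) ^+ 2 <= (M * r ^+ k) ^+ 2.

(** A finite limsup bounds the roots on one neighborhood of infinity; the remaining degrees only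
    affect the constant [M]. *)
Lemma hol0_growth (c : seq 'I_n -> R[i]) : hol0 c ->
  exists M r, [/\ 1 <= M, 1 <= r & geometric_growth c M r].
Proof.
rewrite /hol0 /limn_esup /limf_esup.
set s := fun k => \sum_(a : k.-tuple 'I_n) nrm (c a) ^+ 2.
have s0 k : 0 <= s k by rewrite sumr_ge0// => a _; exact: sqr_ge0.
move=> /ereal_inf_lt[_ [V Voo <-] supV].
have [B VB] : exists B : R, forall k, V k -> s k `^ (2 * k%:R)^-1 <= B.
  move: supV; set S := ereal_sup _ => Soo.
  have Sub k : V k -> ((s k `^ (2 * k%:R)^-1)%:E <= S)%E.
    by move=> Vk; apply: ereal_sup_ubound; exists k.
  case: S Soo Sub => [B| |] // _ Sub; first by exists B => k /Sub; rewrite lee_fin.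
  by exists 0 => k /Sub.
(* This dominates both [B], whose sign is unknown, and [1]. *)
pose r := B ^+ 2 + 1.
have r1 : 1 <= r by rewrite /r lerDr sqr_ge0.
have [||M M1 MP] := @near_le_bound R s (fun k => (r ^+ k) ^+ 2).
- by move=> k; rewrite !exprn_gt0// (lt_le_trans ltr01).
- near=> k.
  have k0 : (0 < k)%N by near: k; exists 1%N.
  have Vk : V k by near: k.
  rewrite -(powR_root (s0 k) k0) -exprM mulnC.
  rewrite lerXn2r ?nnegrE ?powR_ge0 ?(le_trans ler01)//.
  by rewrite (le_trans (VB _ Vk))// /r; nra.
exists M, r; split => // k; rewrite (le_trans (MP k))// exprMn ler_wpM2r ?sqr_ge0//.
by rewrite expr2 ler_peMl// (le_trans ler01).
Unshelve. all: by end_near. Qed.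

Variables (H : hilbertType R) (T : 'I_n -> bop H).

Definition homogeneous (c : seq 'I_n -> R[i]) k : bop H :=
  \sum_(a : k.-tuple 'I_n) c a *: word_op T a.

Hypothesis T_qn : quasi_nilpotent T.

(** The row norms decay faster than every geometric rate, with a constant depending on the rate;
    this compensates any geometric growth of coefficients. *)
Lemma quasi_nilpotent_decay (e : R) : 0 < e ->
  exists2 C, 1 <= C & forall k, level_norm T k <= (C * e ^+ k) ^+ 2.
Proof.
move=> e0.
have [||C C1 CP] := @near_le_bound R (level_norm T) (fun k => (e ^+ k) ^+ 2).
- by move=> k; rewrite !exprn_gt0.
- move/cvgrPdist_le : T_qn => /(_ _ e0) Te; near=> k.
  have k0 : (0 < k)%N by near: k; exists 1%N.
  rewrite -(powR_root (level_norm_ge0 T k) k0) -exprM mulnC.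
  rewrite lerXn2r ?nnegrE ?powR_ge0 ?(ltW e0)//.
  have : `|0 - level_norm T k `^ (2 * k%:R)^-1| <= e by near: k.
  by rewrite sub0r normrN ger0_norm ?powR_ge0.
exists C => // k; rewrite (le_trans (CP k))// exprMn ler_wpM2r ?sqr_ge0//.
by rewrite expr2 ler_peMl// (le_trans ler01).
Unshelve. all: by end_near. Qed.

Lemma nrm_homogeneous (c : seq 'I_n -> R[i]) k (t s : R) : 0 <= t -> 0 <= s ->
  level_norm T k <= t ^+ 2 ->
  \sum_(a : k.-tuple 'I_n) nrm (c a) ^+ 2 <= s ^+ 2 ->
  nrm (homogeneous c k) <= t * s.
Proof.
move=> t0 s0 Tt cs; rewrite -ler_sqr ?nnegrE ?nrm_ge0 ?mulr_ge0//.
rewrite (le_trans (nrm_word_sum _ _ _))// exprMn ler_pM ?level_norm_ge0//.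
by rewrite sumr_ge0// => a _; exact: sqr_ge0.
Qed.

Lemma fcalc_cvg (c : seq 'I_n -> R[i]) M r : 1 <= M -> 1 <= r -> geometric_growth c M r ->
  series (homogeneous c) @ \oo --> fcalc c T.
Proof.
move=> M1 r1 cMr.
have M0 : 0 < M := lt_le_trans ltr01 M1.
have r0 : 0 < r := lt_le_trans ltr01 r1.
have [C C1 CP] :=
  (* The rate [1 / (2 r)] beats the growth [r ^+ k] and leaves the summable bound [C M 2^-k] on the
     part of degree [k]. *)
  quasi_nilpotent_decay (divr_gt0 (ltr0Sn R 0) (mulr_gt0 (ltr0Sn R 1) r0)).
have C0 : 0 < C := lt_le_trans ltr01 C1.
apply: (bop_series_cvg (v := geometric (C * M) 2^-1)); last first.
  by apply: is_cvg_geometric_series; rewrite ger0_norm ?invr_ge0// invf_lt1// ltr1n.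
move=> k; apply: le_trans (nrm_homogeneous _ _ (CP k) (cMr k)) _.
- by rewrite mulr_ge0 ?exprn_ge0 ?ltW// divr_gt0// mulr_gt0.
- by rewrite mulr_ge0 ?exprn_ge0 ?ltW.
rewrite /= mulrACA -exprMn div1r invfM mulrVK ?unitfE ?gt_eqF//.
Qed.

End growth.

(** * The spectrum of a power series in a quasi-nilpotent tuple *)

(** Concatenation is a bijection from pairs of words of lengths [k] and [j] onto words of length
    [k + j]. *)
Lemma sum_tuple_cat (n k j : nat) (V : nmodType) (F : seq 'I_n -> seq 'I_n -> V) :
  \sum_(e : (k + j).-tuple 'I_n) F (take k e) (drop k e) =
  \sum_(a : k.-tuple 'I_n) \sum_(b : j.-tuple 'I_n) F a b.
Proof.
rewrite pair_bigA/= (reindex (fun p : k.-tuple 'I_n * j.-tuple 'I_n =>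
  cat_tuple p.1 p.2))/=; last first.
  have tk (e : (k + j).-tuple 'I_n) : size (take k e) == k.
    by rewrite size_takel ?size_tuple// leq_addr.
  have dk (e : (k + j).-tuple 'I_n) : size (drop k e) == j.
    by rewrite size_drop size_tuple addKn.
  exists (fun e => (Tuple (tk e), Tuple (dk e))) => [[a b] _|e _].
    congr (_, _); apply: val_inj => /=.
      by rewrite take_size_cat// size_tuple.
    by rewrite drop_size_cat// size_tuple.
  by apply: val_inj; rewrite /= cat_take_drop.
by apply: eq_bigr => -[a b] _ /=; rewrite take_size_cat ?drop_size_cat ?size_tuple.
Qed.

Lemma sum_tuple0 (n : nat) (V : nmodType) (F : seq 'I_n -> V) :
  \sum_(a : 0.-tuple 'I_n) F a = F [::].
Proof.
by rewrite (big_pred1 [tuple])// => a; apply/esym/eqP; exact: tuple0.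
Qed.

(** The Neumann series. The hypothesis bears on the powers, since [X] itself may have large norm. *)
Lemma bop_neumann (R : realType) (V : completeNormedModType R[i]) (X : bop V)
  (C : R) : (forall N, nrm (X ^+ N) <= C * 2^-1 ^+ N) ->
  exists B, (1 - X) * B = 1 /\ B * (1 - X) = 1.
Proof.
move=> XC.
have cX : cvgn (series (fun N => X ^+ N)).
  apply: (bop_series_cvg (v := geometric C 2^-1)) => //.
  by apply: is_cvg_geometric_series; rewrite ger0_norm ?invr_ge0// invf_lt1// ltr1n.
have X0 : (fun N => 1 - X ^+ N) @ \oo --> (1 : bop V).
  rewrite -[X in _ --> X]subr0; apply: cvgB; first exact: cvg_cst.
  have C0 : geometric C 2^-1 @ \oo --> (0 : R).
    by apply: cvg_geometric; rewrite ger0_norm ?invr_ge0// invf_lt1// ltr1n.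
  apply/cvg_nrmP; apply: squeeze_cvgr (@cvg_cst _ _ _ _ _) C0.
  by apply: nearW => N; rewrite nrm_ge0 subr0 XC.
have geo N : (1 - X) * series (fun N => X ^+ N) N = 1 - X ^+ N.
  by rewrite -[RHS]opprB subrX1 -mulNr opprB /series/= big_mkord.
have geor N : series (fun N => X ^+ N) N * (1 - X) = 1 - X ^+ N.
  rewrite -geo; apply/commrB; first by rewrite /GRing.comm mulr1 mul1r.
  rewrite /series/= big_mkord; apply/commr_sym/commr_sum => i _.
  exact/commrX/commr_refl.
exists (limn (series (fun N => X ^+ N))); split.
  apply: cvgn_unique X0; rewrite (_ : (fun N => _) =
    fun N => (1 - X) * series (fun N => X ^+ N) N); first exact: cvg_bopMl.
  by apply/funext => N; rewrite geo.
apply: cvgn_unique X0; rewrite (_ : (fun N => _) =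
  fun N => series (fun N => X ^+ N) N * (1 - X)); first exact: cvg_bopMr.
by apply/funext => N; rewrite geor.
Qed.

Section spectrum.
Variables (R : realType) (n : nat) (H : hilbertType R) (T : 'I_n -> bop H).
Hypothesis T_qn : quasi_nilpotent T.

Lemma homogeneousM (d c : seq 'I_n -> R[i]) k j :
  homogeneous T d k * homogeneous T c j =
  homogeneous T (fun e => d (take k e) * c (drop k e)) (k + j).
Proof.
rewrite /homogeneous (eq_bigr (fun e : (k + j).-tuple 'I_n =>
  (fun a b => (d a * c b) *: (word_op T a * word_op T b)) (take k e) (drop k e))).
  rewrite (sum_tuple_cat _ _ (fun a b => (d a * c b) *: (word_op T a * word_op T b))).
  rewrite mulr_suml; apply: eq_bigr => a _; rewrite mulr_sumr.
  by apply: eq_bigr => b _; rewrite bop_scaleMl bop_scaleMr scalerA.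
by move=> e _; rewrite -word_op_cat cat_take_drop.
Qed.

(** For fixed degrees a word factors in only one way, so no convolution occurs and the l^2 norms of
    the coefficients multiply exactly. *)
Lemma sum_sqr_homogeneousM (d c : seq 'I_n -> R[i]) k j :
  \sum_(e : (k + j).-tuple 'I_n) nrm (d (take k e) * c (drop k e)) ^+ 2 =
  (\sum_(a : k.-tuple 'I_n) nrm (d a) ^+ 2) *
  (\sum_(b : j.-tuple 'I_n) nrm (c b) ^+ 2).
Proof.
rewrite (sum_tuple_cat _ _ (fun a b => nrm (d a * c b) ^+ 2)) mulr_suml.
apply: eq_bigr => a _; rewrite mulr_sumr.
by apply: eq_bigr => b _; rewrite nrmM exprMn.
Qed.

(* The powers of G only see products of coefficients of c of total degree N at
   least, while products of |T_a| would lose the decay of the joint norms; hence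
   the homogeneous factor on the left, which absorbs one factor G at a time. *)
Lemma fcalc_pow_le (c : seq 'I_n -> R[i]) (M r q : R) : c [::] = 0 ->
  1 <= M -> 1 <= r -> geometric_growth c M r -> 0 < q ->
  exists2 C, 0 <= C & forall N, nrm (fcalc c T ^+ N) <= C * q ^+ N.
Proof.
move=> c0 M1 r1 cMr q0.
have M0 : 0 < M := lt_le_trans ltr01 M1.
have r0 : 0 < r := lt_le_trans ltr01 r1.
(* For [x <= 1/2] the sum of [M x ^+ j] over [j >= 1] is at most [2 M x], hence at most [q]; the
   tuple is then made to decay at rate [rho = x / r]. *)
have [x [x0 x2 Mx]] : exists x : R, [/\ 0 < x, x <= 2^-1 & 2 * M * x <= q].
  exists (Num.min 2^-1 (q / (2 * M))); split.
  - by rewrite lt_min invr_gt0 ltr0n divr_gt0// mulr_gt0.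
  - by rewrite ge_min lexx.
  - by rewrite mulrC -ler_pdivlMr ?mulr_gt0// ge_min lexx orbT.
have [rho rho0 xE] : exists2 rho : R, 0 < rho & x = rho * r.
  by exists (x / r); rewrite ?divr_gt0// divfK// gt_eqF.
have [C C1 CP] := quasi_nilpotent_decay T_qn rho0.
have C0 : 0 <= C := le_trans ler01 C1.
have geo K : \sum_(j < K) (if j == 0 :> nat then 0 else M * x ^+ j) <= q.
  (* A closed form that survives induction; its last term only corrects the empty sum [K = 0]. *)
  suff : \sum_(j < K) (if j == 0 :> nat then 0 else M * x ^+ j) <=
      M * (2 * x - 2 * x ^+ K) + (K == 0)%:R * (2 * M * (1 - x)).
    have xK : 0 <= x ^+ K by rewrite exprn_ge0// ltW.
    case: K xK => [|K] xK; first by rewrite !big_ord0 (ltW q0).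
    rewrite mul0r addr0 => /le_trans; apply.
    by have := mulr_ge0 (ltW M0) xK; nra.
  elim: K => [|K IH]; first by rewrite big_ord0 eqxx expr0 mul1r; nra.
  rewrite big_ord_recr/=; case: K IH => [|K] IH.
    by rewrite big_ord0 addr0 mul0r expr1 subrr mulr0 addr0.
  rewrite /= !mul0r !addr0 in IH *; apply: (le_trans (lerD IH (lexx _))).
  have xK : 0 <= x ^+ K.+1 by rewrite exprn_ge0// ltW.
  have x12 : 0 <= 1 - 2 * x by lra.
  by have := mulr_ge0 (mulr_ge0 (ltW M0) xK) x12; rewrite (exprS x K.+1); nra.
set G := fcalc c T.
have Gl : series (homogeneous T c) @ \oo --> G := fcalc_cvg T_qn M1 r1 cMr.
(* Generalized over the degree [k] and the coefficients [d]: one factor [G] is expanded, each of its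
   parts merges with [d] into degree [k + j], and the vanishing part of degree 0 leaves a geometric
   sum bounded by [q]. *)
have key N : forall k (d : seq 'I_n -> R[i]) (s : R), 0 <= s ->
    \sum_(a : k.-tuple 'I_n) nrm (d a) ^+ 2 <= s ^+ 2 ->
    nrm (homogeneous T d k * G ^+ N) <= C * rho ^+ k * s * q ^+ N.
  elim: N => [|N IH] k d s s0 ds.
    rewrite !expr0 !mulr1; apply: nrm_homogeneous (CP k) ds => //.
    by rewrite mulr_ge0 ?exprn_ge0 ?(ltW rho0).
  rewrite exprS mulrA.
  apply: (@nrm_cvg_le _ _
    (fun K => homogeneous T d k * series (homogeneous T c) K * G ^+ N)).
    by apply: cvg_bopMr; exact: cvg_bopMl.
  apply: nearW => K; rewrite /series/= big_mkord mulr_sumr mulr_suml.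
  rewrite (le_trans (ler_nrm_sum _ _ _))//.
  apply: (@le_trans _ _ (\sum_(j < K) (C * rho ^+ k * s * q ^+ N) *
      (if j == 0 :> nat then 0 else M * x ^+ j))).
    apply: ler_sum => j _; have [j0|j0] := eqVneq (j : nat) 0%N.
      rewrite j0 {2}/homogeneous big1 ?mulr0 ?mul0r ?nrm0// => a _.
      by rewrite (tuple0 a) c0 scale0r.
    rewrite homogeneousM; apply: le_trans (IH _ _ (s * (M * r ^+ j)) _ _) _.
    - by rewrite !mulr_ge0 ?exprn_ge0 ?(ltW M0) ?(ltW r0).
    - rewrite sum_sqr_homogeneousM exprMn ler_pM//.
        by rewrite sumr_ge0// => a _; exact: sqr_ge0.
      by rewrite sumr_ge0// => a _; exact: sqr_ge0.
    - by rewrite xE exprMn exprD le_eqVlt; apply/orP; left; apply/eqP; ring.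
  rewrite -mulr_sumr exprS [leRHS](_ : _ = C * rho ^+ k * s * q ^+ N * q); last by ring.
  by apply: ler_wpM2l (geo K); rewrite !mulr_ge0 ?exprn_ge0 ?(ltW rho0) ?(ltW q0).
exists C => // N.
have -> : G ^+ N = homogeneous T (fun=> 1) 0 * G ^+ N.
  rewrite /homogeneous (sum_tuple0 (fun a => 1 *: word_op T a)).
  by rewrite /word_op big_nil scale1r mul1r.
rewrite (le_trans (key _ _ _ 1 ler01 _)) ?expr0 ?mulr1//.
by rewrite (sum_tuple0 (fun=> nrm (1 : R[i]) ^+ 2)) nrm_real normr1.
Qed.

Definition off_constant (c : seq 'I_n -> R[i]) (a : seq 'I_n) : R[i] :=
  if a is [::] then 0 else c a.

Lemma off_constant_growth c M r : geometric_growth c M r ->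
  geometric_growth (off_constant c) M r.
Proof.
move=> cMr k; rewrite (le_trans _ (cMr k))// ler_sum// => a _.
by case: (tval a) => [|i b] //=; rewrite nrm0 expr0n sqr_ge0.
Qed.

Lemma fcalc_split c M r : 1 <= M -> 1 <= r -> geometric_growth c M r ->
  fcalc c T = c [::] *: (1 : bop H) + fcalc (off_constant c) T.
Proof.
move=> M1 r1 cMr.
have cl := fcalc_cvg T_qn M1 r1 cMr.
have dl := fcalc_cvg T_qn M1 r1 (off_constant_growth cMr).
apply: (cvgn_unique cl).
have -> : c [::] *: (1 : bop H) + fcalc (off_constant c) T =
  fcalc (off_constant c) T + c [::] *: (1 : bop H) by rewrite addrC.
(* Partial sums are taken up to [N.+1] so that the level 0, which carries the constant term, is
   present. *)
have h N : series (homogeneous T c) N.+1 =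
    series (homogeneous T (off_constant c)) N.+1 + c [::] *: (1 : bop H).
  rewrite /series/= !big_nat_recl// [in RHS]addrAC; congr (_ + _).
    rewrite /homogeneous (sum_tuple0 (fun a => c a *: word_op T a)).
    rewrite (sum_tuple0 (fun a => off_constant c a *: word_op T a)) scale0r add0r.
    by rewrite /word_op big_nil.
  apply: eq_bigr => k _; apply: eq_bigr => a _.
  by case/tupleP: a.
rewrite -(cvg_shiftS (series (homogeneous T c))).
rewrite (_ : (fun N => _) = fun N =>
  series (homogeneous T (off_constant c)) N.+1 + c [::] *: (1 : bop H));
  last exact/funext.
apply: cvgD; last exact: cvg_cst.
by move: dl; rewrite -(cvg_shiftS (series (homogeneous T (off_constant c)))).
Qed.

(** For [w = z - f(0)] nonzero, [z - f(T) = w (1 - w^-1 G)] with [G] free of constant term. The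
    powers of [G] are bounded by a constant times [(|w| / 2)^N], so the Neumann series inverts the
    bracket. *)
Lemma fcalc_spectrum c M r : 1 <= M -> 1 <= r -> geometric_growth c M r ->
  spectrum (fcalc c T) `<=` [set c [::]].
Proof.
move=> M1 r1 cMr z; rewrite /spectrum/= => nz; apply: contrapT => zc; apply: nz.
have zc0 : z - c [::] != 0 by rewrite subr_eq0; apply/eqP.
have w0 : 0 < nrm (z - c [::]) by rewrite nrm_gt0.
set w := z - c [::] in zc0 w0.
have [C C0 CP] := fcalc_pow_le erefl M1 r1 (off_constant_growth cMr)
  (divr_gt0 w0 (ltr0Sn R 1)).
set G := fcalc (off_constant c) T in CP.
have XN N : (w^-1 *: G) ^+ N = (w ^- N) *: G ^+ N.
  elim: N => [|N IH]; first by rewrite !expr0 invr1 scale1r.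
  by rewrite !exprS IH bop_scaleMl bop_scaleMr scalerA invfM.
have [B [B1 B2]] : exists B, (1 - w^-1 *: G) * B = 1 /\ B * (1 - w^-1 *: G) = 1.
  apply: (@bop_neumann _ _ _ C) => N; rewrite XN nrmZ.
  have nw : nrm (w ^- N) = (nrm w ^+ N)^-1.
    by apply: nrm_eqR; rewrite normfV normrX nrmE -rmorphXn fmorphV.
  rewrite nw mulrC ler_pdivrMr ?exprn_gt0// (le_trans (CP N))//.
  by rewrite -mulrA -exprMn mulrC [in leRHS]mulrC [2^-1 * _]mulrC.
have zE : z *: (1 : bop H) - fcalc c T = w *: (1 - w^-1 *: G).
  rewrite (fcalc_split M1 r1 cMr) scalerBr scalerA divff// scale1r.
  by rewrite opprD addrA -scalerBl.
exists (w^-1 *: B); rewrite zE !bop_scaleMl !bop_scaleMr B1 B2 !scalerA.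
by rewrite divff// mulVf// scale1r.
Qed.

End spectrum.

(** * Radial weighted shifts *)

Section fock_coefficients.
Variables (R : realType) (n : nat).
Local Notation F2 := (fock R n).
Local Notation e0 := (fock_basis R ([::] : seq 'I_n)).

Lemma sum_level_single (V : nmodType) (u : seq 'I_n -> V) c N :
  (forall a, a != c -> u a = 0) -> (size c < N)%N ->
  \sum_(0 <= k < N) \sum_(a : k.-tuple 'I_n) u a = u c.
Proof.
move=> uc cN; rewrite (bigD1_seq (size c)) ?mem_index_iota ?iota_uniq//=.
rewrite (bigD1 (in_tuple c))//= !big1 ?addr0// => [k kc|a ac].
  apply: big1 => a _; apply: uc; apply: contra_neq kc => <-.
  by rewrite size_tuple.
by apply: uc; apply: contra_neq ac => ac; exact: val_inj.
Qed.

Lemma level_sum_single (u : seq 'I_n -> R) c :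
  (forall a, a != c -> u a = 0) -> level_sum u = u c.
Proof.
move=> uc; apply: cvg_lim => //; apply: cvg_near_cst.
by exists (size c).+1 => // N /= cN; exact: sum_level_single.
Qed.

Lemma dotp_basis (f : F2) c : dotp f (fock_basis R c) = f c.
Proof.
have conj_basis a : (fock_basis R c a : R[i])^* = (a == c)%:R by exact: conjc_nat.
rewrite -[LHS]/(fock_dot f (fock_basis R c)) /fock_dot !(@level_sum_single _ c).
- by cbv beta; rewrite conj_basis eqxx mulr1; case: (f c).
- by move=> a /negPf ac; cbv beta; rewrite conj_basis ac mulr0.
- by move=> a /negPf ac; cbv beta; rewrite conj_basis ac mulr0.
Qed.

Lemma basis_dotp (f : F2) c : dotp (fock_basis R c) f = (f c)^*.
Proof. by rewrite dotpC dotp_basis. Qed.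

Lemma nrm_basis c : nrm (fock_basis R c : F2) = 1.
Proof.
apply/eqP; rewrite -(@eqrXn2 _ 2)// ?nrm_ge0// expr1n nrm_sqrE dotp_basis.
by rewrite /= eqxx.
Qed.

Lemma nrm_coef_le (f : F2) a : nrm (f a) <= nrm f.
Proof. exact: fock_coef_le. Qed.

Lemma fock_nrm_le (f g : F2) (C : R) : 0 <= C ->
  (forall a, nrm (f a) <= C * nrm (g a)) -> nrm f <= C * nrm g.
Proof.
move=> C0 fg; apply: fock_norm_le_partial => [|N]; first by rewrite mulr_ge0 ?nrm_ge0.
rewrite exprMn; apply: le_trans (ler_wpM2l (sqr_ge0 C) (fock_partial_le g N)).
rewrite /series/= mulr_sumr ler_sum// => k _; rewrite /level mulr_sumr ler_sum// => a _.
by rewrite -exprMn ler_sqr ?nnegrE ?mulr_ge0 ?nrm_ge0.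
Qed.

Lemma cvg_coef (u : nat -> F2) (f : F2) a :
  u @ \oo --> f -> (fun k => u k a : R[i]^o) @ \oo --> (f a : R[i]^o).
Proof.
by apply: (@cvg_nrm_le _ _ _ _ _ _ _ 1) => k; rewrite mul1r;
  exact: (nrm_coef_le (u k - f)).
Qed.

Lemma fock_sumE (I : Type) (r : seq I) (P : pred I) (F : I -> F2) a :
  (\sum_(i <- r | P i) F i) a = \sum_(i <- r | P i) (F i a : R[i]).
Proof. by elim/big_rec2 : _ => [|i y f _ <-]. Qed.

Lemma fockZ (z : R[i]) (f : F2) a : (z *: f) a = z * (f a : R[i]) :> R[i].
Proof. by []. Qed.

End fock_coefficients.

Section radial_shift.
Variables (R : realType) (n : nat) (w : nat -> R) (B : R).
Hypothesis wB : forall k, 0 <= w k <= B.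
Local Notation F2 := (fock R n).
Local Notation e0 := (fock_basis R ([::] : seq 'I_n)).

Let w_ge0 k : 0 <= w k. Proof. by have /andP[] := wB k. Qed.

Definition radial_fun (f : F2) (a : seq 'I_n) : R[i]^o := (w (size a))%:C * (f a : R[i]).

Let nrm_radial_fun (f : F2) a : nrm (radial_fun f a) <= B * nrm (f a).
Proof.
rewrite nrmM nrm_real ler_wpM2r ?nrm_ge0//.
by have /andP[w0 wle] := wB (size a); rewrite ger0_norm.
Qed.

Lemma radial_summable (f : F2) : radial_fun f \in @square_summable R n.
Proof.
apply/asboolP; apply: (@level_cvg_le _ _ _ (fun a => B ^+ 2 * nrm (f a) ^+ 2)).
  2: exact/level_cvgZ/fock_cvg.
move=> a; rewrite ger0_norm ?sqr_ge0// -exprMn ler_sqr ?nnegrE ?nrm_ge0//.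
rewrite mulr_ge0 ?nrm_ge0//; have /andP[] := wB 0%N; exact: le_trans.
Qed.

Definition radial_fock (f : F2) : F2 := Fock (radial_summable f).

Lemma radial_bounded : radial_fock \in @bounded_linear R F2.
Proof.
apply/asboolP; split => [z f g|].
  apply: fockP => a; rewrite /= /radial_fun.
  change ((w (size a))%:C * (z * (f a : R[i]) + (g a : R[i])) =
    z * ((w (size a))%:C * (f a : R[i])) + (w (size a))%:C * (g a : R[i])).
  by rewrite mulrDr mulrCA.
exists B => f; apply: fock_nrm_le => [|a]; last exact: nrm_radial_fun.
by have /andP[] := wB 0%N; exact: le_trans.
Qed.

(** A diagonal operator followed by a creation operator, so that boundedness comes from the two
    factors. *)
Definition radial_shift (i : 'I_n) : bop F2 := creation R i * BOp radial_bounded.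

Lemma radial_shift_cons i f j b : radial_shift i f (j :: b) =
  if j == i then (w (size b))%:C * (f b : R[i]) else 0.
Proof. by []. Qed.

Lemma radial_shift_basis i a :
  radial_shift i (fock_basis R a) = (w (size a))%:C *: fock_basis R (i :: a).
Proof.
apply: fockP => -[|j b]; rewrite fockZ ?mulr0// radial_shift_cons /= eqseq_cons.
case: (j == i); rewrite ?mulr0//=.
by have [->|] := eqVneq b a; rewrite ?mulr0.
Qed.

Lemma radial_shift_weighted : weighted_multishift radial_shift.
Proof.
exists (fun a => if a is i :: b then w (size b) else 0); split.
- by case.
- by move=> i; exists B => _ [a _ <-]; have /andP[] := wB (size a).
- by move=> i a; rewrite radial_shift_basis.
Qed.

(** The letters of [a] are prepended one at a time to the suffix left in [e]; each step collects the
    weight of the length before it, hence the range from [|e| - |a|] to [|e| - 1]. *)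
Lemma word_shiftE a f e : word_op radial_shift a f e =
  if take (size a) e == a then
    (\prod_(size e - size a <= k < size e) w k)%:C * (f (drop (size a) e) : R[i])
  else 0.
Proof.
elim: a e => [|i a IH] e.
  by rewrite /word_op big_nil bop1 take0 drop0 subn0 big_geq// eqxx mul1r.
rewrite /word_op big_cons bopM -/(word_op _ _); case: e => [//|j b].
rewrite radial_shift_cons IH /= eqseq_cons; case: (j == i) => //=.
case: eqP => [ab|_]; last by rewrite mulr0.
have lab : (size a <= size b)%N.
  by rewrite -{1}ab size_take_min geq_minr.
rewrite subSS big_nat_recr ?leq_subr//= rmorphM/=.
by rewrite mulrA [_%:C * _%:C]mulrC.
Qed.

Definition radial_weight k : R := \prod_(i < k) w i.

Lemma radial_weight_ge0 k : 0 <= radial_weight k.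
Proof. by rewrite prodr_ge0. Qed.

Lemma word_shift_basis a b : word_op radial_shift a (fock_basis R b) =
  (\prod_(size b <= k < size a + size b) w k)%:C *: fock_basis R (a ++ b).
Proof.
apply: fockP => e; rewrite word_shiftE fockZ /=.
have [ea|ea] := eqVneq (take (size a) e) a; last first.
  suff /negPf -> : e != a ++ b by rewrite mulr0.
  by apply: contra_neq ea => ->; rewrite take_size_cat.
have -> : (e == a ++ b) = (drop (size a) e == b).
  by rewrite -{1}(cat_take_drop (size a) e) ea eqseq_cat// eqxx.
have [db|_] := eqVneq; last by rewrite !mulr0.
have -> : size e = (size a + size b)%N.
  by rewrite -{1}(cat_take_drop (size a) e) ea db size_cat.
by rewrite addKn.
Qed.

Lemma word_shift_vacuum a :
  word_op radial_shift a e0 = (radial_weight (size a))%:C *: fock_basis R a.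
Proof. by rewrite word_shift_basis cats0 addn0 big_mkord. Qed.

(** A coefficient is a pairing with a basis vector, on which the word operator itself can be
    evaluated. *)
Lemma adjoint_shiftE a f b : adjoint (word_op radial_shift a) f b =
  (\prod_(size b <= k < size a + size b) w k)%:C * (f (a ++ b) : R[i]).
Proof.
apply: (can_inj (@conjcK R)).
change ((adjoint (word_op radial_shift a) f b : R[i])^* =
  ((\prod_(size b <= k < size a + size b) w k)%:C * (f (a ++ b) : R[i]))^*).
rewrite -basis_dotp -adjointP word_shift_basis dotpZl basis_dotp.
by rewrite conj_realM.
Qed.

(** At [e] only the word equal to the prefix of length [k] contributes, so the row operator is
    diagonal. *)
Lemma level_shiftE k f e :
  (\sum_(a : k.-tuple 'I_n)
     word_op radial_shift a * adjoint (word_op radial_shift a)) f e =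
  if (k <= size e)%N then
    ((\prod_(size e - k <= i < size e) w i) ^+ 2)%:C * (f e : R[i]) else 0.
Proof.
rewrite bop_sum fock_sumE.
have termE (a : k.-tuple 'I_n) :
    (word_op radial_shift a * adjoint (word_op radial_shift a)) f e =
    if take k e == a then
      ((\prod_(size e - k <= i < size e) w i) ^+ 2)%:C * (f e : R[i]) else 0.
  rewrite bopM word_shiftE size_tuple; case: eqP => // ea.
  rewrite adjoint_shiftE size_tuple -ea cat_take_drop size_drop.
  have ke : (k <= size e)%N.
    by have := size_tuple a; rewrite -ea size_take; case: ltnP => [/ltnW|_ ->].
  by rewrite subnKC// mulrA -rmorphM -expr2.
rewrite (eq_bigr _ (fun a _ => termE a)); case: leqP => ke.
  have te : size (take k e) == k by rewrite size_takel.
  rewrite (bigD1 (Tuple te))//= eqxx [X in _ + X]big1 ?addr0// => a ae.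
  by case: eqP => // ea; move/eqP : ae; case; apply: val_inj.
apply: big1 => a _; case: eqP => // ea.
have := size_tuple a; rewrite -ea size_take ltnNge (ltnW ke)/= => ek.
by rewrite ek ltnn in ke.
Qed.

Hypothesis w_noninc : forall i j, (i <= j)%N -> w j <= w i.

(** Since the weights do not increase, a product of [k] consecutive ones is largest at the start. *)
Lemma level_shift_le k : level_norm radial_shift k <= radial_weight k ^+ 2.
Proof.
apply: nrm_bop_le => [|f]; first exact: sqr_ge0.
apply: fock_nrm_le => [|e]; first exact: sqr_ge0.
rewrite level_shiftE; case: leqP => ke; last first.
  by rewrite nrm0 mulr_ge0 ?sqr_ge0 ?nrm_ge0.
rewrite nrmM nrm_real ger0_norm ?sqr_ge0// ler_wpM2r ?nrm_ge0//.
rewrite ler_sqr ?nnegrE ?radial_weight_ge0 ?prodr_ge0//.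
have [m ->] : exists m, size e = (m + k)%N by exists (size e - k)%N; rewrite subnK.
rewrite addnK -{1}[m]add0n big_addn addKn big_mkord.
by apply: ler_prod => i _; rewrite w_ge0 w_noninc// leq_addr.
Qed.

(** Evaluate the diagonal operator at [e_a]. The length is given by a word because for [n = 0] no
    word has positive length and the level norm vanishes there. *)
Lemma level_shift_ge (a : seq 'I_n) :
  radial_weight (size a) ^+ 2 <= level_norm radial_shift (size a).
Proof.
rewrite -[leRHS]mulr1 -(nrm_basis R a); apply: le_trans (nrm_bop _ _).
rewrite (le_trans _ (nrm_coef_le _ a))// level_shiftE leqnn subnn big_mkord /=.
by rewrite eqxx mulr1 nrm_real ger0_norm ?sqr_ge0.
Qed.

Hypothesis w_cvg0 : w @ \oo --> (0 : R).

(** From some rank on every factor is at most [e / 2]; the spare [2^-k] absorbs the constant due to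
    the first factors. *)
Lemma radial_weight_decay (e : R) : 0 < e ->
  \forall k \near \oo, radial_weight k <= e ^+ k.
Proof.
move=> e_gt0; have e2 : 0 < e / 2 by rewrite divr_gt0.
move/cvgrPdist_le : w_cvg0 => /(_ _ e2)[N _ wN].
have le k : radial_weight (N + k) <= radial_weight N * (e / 2) ^+ k.
  elim: k => [|k IH]; first by rewrite addn0 mulr1.
  rewrite addnS /radial_weight big_ord_recr/= exprSr mulrA.
  apply: ler_pM => //; first exact: radial_weight_ge0.
  by have := wN _ (leq_addr k N); rewrite /= sub0r normrN ger0_norm.
pose C := radial_weight N / e ^+ N.
have C0 : (fun k => C * 2^-1 ^+ k) @ \oo --> (0 : R).
  by apply: cvg_geometric; rewrite ger0_norm ?invr_ge0// invf_lt1// ltr1n.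
move/cvgrPdist_le : C0 => /(_ _ ltr01)[N' _ CN]; exists (N + N')%N => // k /= Nk.
have Nk' : (N <= k)%N := leq_trans (leq_addr _ _) Nk.
rewrite -(subnKC Nk') (le_trans (le _))//.
have -> : radial_weight N * (e / 2) ^+ (k - N) =
    C * 2^-1 ^+ (k - N) * e ^+ (N + (k - N)).
  by rewrite /C exprD exprMn; field; rewrite expf_neq0// gt_eqF.
rewrite ler_piMl ?exprn_ge0 ?(ltW e_gt0)//.
have /CN : (N' <= k - N)%N by rewrite leq_subRL.
by rewrite /= sub0r normrN; apply: le_trans; rewrite ler_norm.
Qed.

Lemma radial_shift_qn : quasi_nilpotent radial_shift.
Proof.
apply/cvgrPdist_le => e e_gt0; near=> k.
have k0 : (0 < k)%N by near: k; exists 1%N.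
rewrite sub0r normrN ger0_norm ?powR_ge0//.
rewrite -(@ler_pXn2r _ (2 * k)) ?muln_gt0// ?nnegrE ?powR_ge0 ?(ltW e_gt0)//.
rewrite powR_root ?level_norm_ge0// (le_trans (level_shift_le _))// mulnC exprM.
rewrite ler_sqr ?nnegrE ?radial_weight_ge0 ?exprn_ge0 ?(ltW e_gt0)//.
by near: k; exact: radial_weight_decay.
Unshelve. all: by end_near. Qed.

Lemma radial_weight_le_power_bound (a : seq 'I_n) :
  radial_weight (size a) <= power_bound radial_shift.
Proof.
have [C C1 CP] := quasi_nilpotent_decay radial_shift_qn ltr01.
apply: (@le_trans _ _ (Num.sqrt (level_norm radial_shift (size a)))).
  rewrite -(ger0_norm (radial_weight_ge0 _)) -sqrtr_sqr ler_wsqrtr//.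
  exact: level_shift_ge.
apply: ub_le_sup; last by exists (size a).
(* Decay at rate 1 bounds the sequence, so [power_bound] is a true supremum. *)
exists C => _ [k _ <-]; rewrite -(ger0_norm (le_trans ler01 C1)) -sqrtr_sqr ler_wsqrtr//.
by rewrite (le_trans (CP k))// expr1n mulr1.
Qed.

Lemma homogeneous_vacuum (c : seq 'I_n -> R[i]) k :
  homogeneous radial_shift c k e0 =
  \sum_(a : k.-tuple 'I_n) (c a * (radial_weight k)%:C) *: fock_basis R a.
Proof.
rewrite /homogeneous bop_sum; apply: eq_bigr => a _.
by rewrite bopZ word_shift_vacuum scalerA size_tuple.
Qed.

(** Only the part of degree [size a] reaches [e_a] from the vacuum, so the coefficient of the
    partial sums is eventually constant. *)
Lemma fcalc_vacuum_coef (c : seq 'I_n -> R[i]) M r a :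
  1 <= M -> 1 <= r -> geometric_growth c M r ->
  fcalc c radial_shift e0 a = c a * (radial_weight (size a))%:C.
Proof.
move=> M1 r1 cMr.
apply: (cvgn_unique (cvg_coef (cvg_bop (fcalc_cvg radial_shift_qn M1 r1 cMr)))).
apply: cvg_near_cst; exists (size a).+1 => // N /= aN.
rewrite /series/= bop_sum fock_sumE.
under eq_bigr => k _ do rewrite homogeneous_vacuum fock_sumE.
pose u b : R[i] := c b * (radial_weight (size b))%:C * (b == a)%:R.
transitivity (\sum_(0 <= k < N) \sum_(b : k.-tuple 'I_n) u b).
  apply: eq_bigr => k _; apply: eq_bigr => b _.
  by rewrite fockZ /u size_tuple eq_sym.
rewrite (@sum_level_single _ _ u a)// /u ?eqxx ?mulr1// => b /negPf ->.
by rewrite mulr0.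
Qed.

(** A nonempty word of shifts has range orthogonal to the vacuum, and this passes to the limit. *)
Lemma fcalc_vacuum_constant (c : seq 'I_n -> R[i]) M r f :
  1 <= M -> 1 <= r -> geometric_growth c M r -> c [::] = 0 ->
  fcalc c radial_shift f [::] = 0.
Proof.
move=> M1 r1 cMr c0.
apply: (cvgn_unique (cvg_coef (cvg_bop (fcalc_cvg radial_shift_qn M1 r1 cMr)))).
rewrite (_ : (fun k => _) = cst 0); first exact: cvg_cst.
apply/funext => N; rewrite /series/= bop_sum fock_sumE big1// => k _.
rewrite bop_sum fock_sumE big1// => a _.
rewrite bopZ fockZ word_shiftE; case: (tval a) => [|i b]; first by rewrite c0 mul0r.
by rewrite mulr0.
Qed.

(** An inverse [D] of [f(0) - f(W) = - G] would give [G D = -1], although the range of [G] is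
    orthogonal to the vacuum. *)
Lemma fcalc_shift_spectrum (c : seq 'I_n -> R[i]) M r :
  1 <= M -> 1 <= r -> geometric_growth c M r ->
  spectrum (fcalc c radial_shift) (c [::]).
Proof.
move=> M1 r1 cMr [D [cD _]].
set G := fcalc (off_constant c) radial_shift.
have GD : G * D = -1.
  rewrite -cD (fcalc_split radial_shift_qn M1 r1 cMr) opprD addrA subrr sub0r.
  by rewrite mulNr opprK.
have := fcalc_vacuum_constant (D e0) M1 r1 (off_constant_growth cMr) erefl.
rewrite -/G -bopM GD => /esym/eqP.
by rewrite -[X in _ == X]/(- (1 : R[i])) eq_sym oppr_eq0 oner_eq0.
Qed.

End radial_shift.

(** * From the shift to the given tuple *)

Section pi_bound.
Variable R : realType.

Lemma sin_le_id (x : R) : 0 <= x -> sin x <= x.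
Proof.
move=> x0; have := @MVT_segment R sin cos 0 x x0 (fun t _ => is_derive_sin t).
case; first exact/continuous_subspaceT/continuous_sin.
by move=> t _; rewrite sin0 !subr0 => ->; rewrite ler_piMl// cos_le1.
Qed.

(** From [sin x <= x] at [x = pi / 4], where [sin x ^+ 2 = 1 / 2]. *)
Lemma pi_sqr_ge8 : 8 <= (pi : R) ^+ 2.
Proof.
have p4 : 0 <= (pi : R) / 4 by rewrite divr_ge0 ?pi_ge0.
have := @cos_mulr2n R (pi / 4).
rewrite (_ : (pi / 4) *+ 2 = pi / 2 :> R) ?cos_pihalf; last by field.
rewrite cos2sin2 => h.
have s2 : sin ((pi : R) / 4) ^+ 2 = 2^-1 by move: h; lra.
have s0 : 0 <= sin ((pi : R) / 4).
  by apply: sin_ge0_pi; rewrite p4 ler_piMr ?pi_ge0// invf_le1// ler1n.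
have := sin_le_id p4; set s := sin _ in s2 s0 *; set p := pi => sp.
have : s ^+ 2 <= (p / 4) ^+ 2 by rewrite ler_sqr ?nnegrE.
by rewrite s2; lra.
Qed.

Lemma pi_sqrt6_sqr : 4 / 3 <= (pi / Num.sqrt 6 : R) ^+ 2.
Proof.
rewrite expr_div_n sqr_sqrtr// ler_pdivlMr// (le_trans _ pi_sqr_ge8)//; lra.
Qed.

End pi_bound.

Lemma sum_pow4_le (R : realType) N : \sum_(0 <= k < N) (4^-1 : R) ^+ k <= 4 / 3.
Proof.
have -> : \sum_(0 <= k < N) (4^-1 : R) ^+ k = 4 / 3 * (1 - 4^-1 ^+ N).
  elim: N => [|N IH]; first by rewrite big_geq// expr0 subrr mulr0.
  by rewrite big_nat_recr//= IH exprS; field.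
have := exprn_ge0 N (_ : 0 <= (4^-1 : R)); rewrite invr_ge0 => /(_ (ler0n _ _)); lra.
Qed.

(** * Weights dominating the tuple *)

Section weights.
Variables (R : realType) (n : nat) (H : hilbertType R) (T : 'I_n -> bop H).

Lemma level_norm0 : level_norm T 0 <= 1.
Proof.
rewrite /level_norm (sum_tuple0 (fun a => word_op T a * adjoint (word_op T a))).
rewrite /word_op big_nil mul1r (_ : adjoint 1 = 1) ?nrm_bop1//.
by apply: bopP => y; apply: dotp_inj => x; rewrite -adjointP.
Qed.

Hypothesis T_qn : quasi_nilpotent T.

Lemma dominating_weights : exists w : nat -> R,
  [/\ forall k, 0 < w k <= w 0%N, forall i j, (i <= j)%N -> w j <= w i,
      w @ \oo --> (0 : R) &
      forall k, 4 ^+ k * level_norm T k <= radial_weight w k ^+ 2].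
Proof.
pose u k := level_norm T k `^ (2 * k%:R)^-1.
(* Shifted by one because the last factor of [radial_weight w k.+1] is [w k]. *)
pose v k := u k.+1.
have v0 : v @ \oo --> (0 : R) by rewrite (cvg_shiftS u).
have vub : has_ubound (range v).
  by apply/bounded_fun_has_ubound/cvg_seq_bounded/cvg_ex; exists 0.
have v_sups k : v k <= sups v k.
  apply: ub_le_sup; last by exists k => /=.
  by have [B vB] := vub; exists B => _ [j _ <-]; apply: vB; exists j.
(* The tail suprema make the sequence nonincreasing with limit 0, the factor 2 produces [4 ^+ k],
   and the harmonic term keeps the weights positive, so that they can be divided by. *)
pose w k := 2 * sups v k + k.+1%:R^-1.
have w_gt0 k : 0 < w k.
  rewrite ltr_wpDl ?invr_gt0// mulr_ge0// (le_trans _ (v_sups k))//.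
  exact: powR_ge0.
have w_noninc i j : (i <= j)%N -> w j <= w i.
  move=> ij; apply: lerD.
    by rewrite ler_pM2l//; exact: nonincreasing_sups.
  by rewrite lef_pV2 ?posrE// ler_nat.
exists w; split => //.
- by move=> k; rewrite w_gt0 w_noninc.
- rewrite -[X in _ --> X](addr0 0) -{1}(mulr0 2); apply: cvgD; last exact: cvg_harmonic.
  by apply: cvgM; [exact: cvg_cst|exact: cvg_sups].
case=> [|k]; first by rewrite mul1r /radial_weight big_ord0 expr1n level_norm0.
rewrite -(powR_root (level_norm_ge0 T k.+1) (ltn0Sn k)) -/(u k.+1) -/(v k).
rewrite (_ : 4 = 2 ^+ 2 :> R); last by rewrite expr2 -natrM.
rewrite -exprM -exprMn mulnC exprM ler_sqr ?nnegrE; last 2 first.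
- by rewrite exprn_ge0// mulr_ge0// powR_ge0.
- by rewrite prodr_ge0// => i _; rewrite ltW.
(* All factors are at least the last one, [w k], which is at least [2 v k]. *)
apply: (@le_trans _ _ (\prod_(i < k.+1) w k)); last first.
  by apply: ler_prod => i _; rewrite ltW//= w_noninc// -ltnS.
rewrite prodr_const card_ord lerXn2r ?nnegrE ?mulr_ge0 ?powR_ge0 ?(ltW (w_gt0 k))//.
by rewrite ler_wpDr ?invr_ge0// ler_pM2l.
Qed.

End weights.

(** * Transfer through the vacuum vector *)

Section transfer.
Variables (R : realType) (n : nat) (H : hilbertType R) (T : 'I_n -> bop H).
Hypothesis T_qn : quasi_nilpotent T.
Variables (w : nat -> R) (B : R).
Hypothesis w_gt0 : forall k, 0 < w k.
Hypothesis wB : forall k, 0 <= w k <= B.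
Hypothesis w_noninc : forall i j, (i <= j)%N -> w j <= w i.
Hypothesis w_cvg0 : w @ \oo --> (0 : R).
Hypothesis w_dom : forall k, 4 ^+ k * level_norm T k <= radial_weight w k ^+ 2.

Local Notation F2 := (fock R n).
Local Notation e0 := (fock_basis R ([::] : seq 'I_n)).
Local Notation W := (@radial_shift R n w B wB).
Variable K : R.
Hypothesis K_ge0 : 0 <= K.
Hypothesis K_sqr : 4 / 3 <= K ^+ 2.

Let W_qn : quasi_nilpotent W.
Proof. exact: radial_shift_qn. Qed.

Let weight_gt0 k : 0 < radial_weight w k.
Proof. by rewrite prodr_gt0. Qed.

(** The conjugate appears because [dotp] is conjugate-linear in its second argument. *)
Definition eta_fun (h y : H) (a : seq 'I_n) : R[i]^o :=
  ((radial_weight w (size a))^-1)%:C * (dotp (word_op T a h) y)^*.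

(** By [level_bessel] and the choice of the weights, level [k] contributes at most
    [4^-k |h|^2 |y|^2]; these sum to at most [4 / 3 <= K ^+ 2]. *)
Lemma eta_partial h y N :
  series (level (fun a => nrm (eta_fun h y a) ^+ 2)) N <= (K * (nrm h * nrm y)) ^+ 2.
Proof.
have hy0 : 0 <= (nrm h * nrm y) ^+ 2 by exact: sqr_ge0.
rewrite exprMn; apply: le_trans (ler_wpM2r hy0 K_sqr).
apply: le_trans (ler_wpM2r hy0 (@sum_pow4_le R N)).
rewrite /series/= mulr_suml ler_sum// => k _; rewrite /level.
have -> : \sum_(a : k.-tuple 'I_n) nrm (eta_fun h y a) ^+ 2 =
    (radial_weight w k ^+ 2)^-1 *
    \sum_(a : k.-tuple 'I_n) nrm (dotp (word_op T a h) y) ^+ 2.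
  rewrite mulr_sumr; apply: eq_bigr => a _.
  rewrite nrmM nrm_conj nrm_real size_tuple exprMn ger0_norm ?exprVn//.
  by rewrite invr_ge0 ltW.
rewrite ler_pdivrMl ?exprn_gt0// (le_trans (level_bessel _ _ _ _))//.
rewrite -mulrA -exprMn [leRHS]mulrA ler_wpM2r// mulrC exprVn ler_pdivlMl ?exprn_gt0//.
Qed.

Lemma eta_summable h y : eta_fun h y \in @square_summable R n.
Proof.
apply/asboolP; apply: nondecreasing_is_cvgn.
  by apply: nondecreasing_series => k _ _; apply: level_ge0 => a; exact: sqr_ge0.
by exists ((K * (nrm h * nrm y)) ^+ 2) => _ [N _ <-]; exact: eta_partial.
Qed.

(* [eta h y] represents the functional [e_a |-> b_a^-1 <T_a h, y>] on the Fock
   space, where [W_a e_0 = b_a e_a]. *)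
Definition eta h y : F2 := Fock (eta_summable h y).

Lemma nrm_eta h y : nrm (eta h y) <= K * (nrm h * nrm y).
Proof.
apply: fock_norm_le_partial; last exact: eta_partial.
by rewrite !mulr_ge0 ?nrm_ge0.
Qed.

Lemma dotp_basis_eta h y a : dotp (fock_basis R a) (eta h y) =
  ((radial_weight w (size a))^-1)%:C * dotp (word_op T a h) y.
Proof.
rewrite basis_dotp -[LHS]/((eta_fun h y a : R[i])^*) /eta_fun.
by rewrite conj_realM conjCK.
Qed.

(** Term by term, the weight that [W_a] collects on the vacuum cancels the inverse weight in [eta];
    both series then pass to the limit. *)
Lemma fcalc_transfer (c : seq 'I_n -> R[i]) M r h y :
  1 <= M -> 1 <= r -> geometric_growth c M r ->
  dotp (fcalc c T h) y = dotp (fcalc c W e0) (eta h y).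
Proof.
move=> M1 r1 cMr.
have lT := cvg_dotpl (cvg_bop (fcalc_cvg T_qn M1 r1 cMr)).
have lW := cvg_dotpl (cvg_bop (fcalc_cvg W_qn M1 r1 cMr)).
apply: (cvgn_unique (lT h y)).
rewrite (_ : (fun k => _) =
  (fun k => dotp (series (homogeneous W c) k e0) (eta h y) : R[i]^o)); first exact: lW.
apply/funext => N; rewrite /series/= !bop_sum !dotp_suml.
apply: eq_bigr => k _; rewrite homogeneous_vacuum bop_sum !dotp_suml.
apply: eq_bigr => a _; rewrite !dotpZl dotp_basis_eta size_tuple -mulrA.
congr (_ * _); rewrite mulrA -rmorphM/= mulfV ?mul1r//.
by rewrite gt_eqF.
Qed.

(** Test with [y = A h]. Stated for an arbitrary pair so that it applies to differences
    [f_k(T) - f(T)] as well. *)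
Lemma nrm_transfer (A : bop H) (xi : F2) :
  (forall h y, dotp (A h) y = dotp xi (eta h y)) -> nrm A <= K * nrm xi.
Proof.
move=> Axi; apply: nrm_bop_le => [|h]; first by rewrite mulr_ge0 ?nrm_ge0.
have [->|Ah0] := eqVneq (A h) 0; first by rewrite nrm0 !mulr_ge0 ?nrm_ge0.
have A0 : 0 < nrm (A h) by rewrite nrm_gt0.
rewrite -(ler_pM2l A0) -expr2 nrm_sqrE Axi (le_trans (Re_dotp_le _ _))//.
apply: (le_trans (ler_wpM2l (nrm_ge0 xi) (nrm_eta h (A h)))).
by rewrite le_eqVlt; apply/orP; left; apply/eqP; ring.
Qed.

Lemma nrm_fcalc_le (c : seq 'I_n -> R[i]) M r :
  1 <= M -> 1 <= r -> geometric_growth c M r ->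
  nrm (fcalc c T) <= K * nrm (fcalc c W e0).
Proof. by move=> M1 r1 cMr; apply: nrm_transfer => h y; exact: fcalc_transfer cMr. Qed.

(** Convergence at the vacuum alone yields norm convergence for [T], which serves both the norm and
    the strong topology. *)
Lemma fcalc_cvg_transfer (c_ : nat -> seq 'I_n -> R[i]) (c : seq 'I_n -> R[i]) :
  (forall k, hol0 (c_ k)) -> hol0 c ->
  (fun k => fcalc (c_ k) W e0) @ \oo --> fcalc c W e0 ->
  (fun k => fcalc (c_ k) T) @ \oo --> fcalc c T.
Proof.
move=> hc_ /hol0_growth[M [r [M1 r1 cMr]]].
apply: (@cvg_nrm_le _ _ _ _ _ _ _ K) => k; apply: nrm_transfer => h y.
have [M' [r' [M1' r1' cMr']]] := hol0_growth (hc_ k).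
by rewrite bopB !dotpBl (fcalc_transfer _ _ M1 r1 cMr) (fcalc_transfer _ _ M1' r1' cMr').
Qed.

Lemma wot_transfer (c_ : nat -> seq 'I_n -> R[i]) (c : seq 'I_n -> R[i]) :
  (forall k, hol0 (c_ k)) -> hol0 c ->
  wot_cvg (fun k => fcalc (c_ k) W) (fcalc c W) ->
  wot_cvg (fun k => fcalc (c_ k) T) (fcalc c T).
Proof.
move=> hc_ /hol0_growth[M [r [M1 r1 cMr]]] cW h y.
rewrite (fcalc_transfer _ _ M1 r1 cMr).
rewrite (_ : (fun k => _) =
  (fun k => dotp (fcalc (c_ k) W e0) (eta h y) : R[i]^o)); first exact: cW.
apply/funext => k; have [M' [r' [M1' r1' cMr']]] := hol0_growth (hc_ k).
exact: fcalc_transfer cMr'.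
Qed.

(** Vector functionals are w*-functionals concentrated on the index 0, so w*-convergence can be
    tested on a single pair of vectors. *)
Lemma wstar_functional_single (A : bop F2) x y :
  wstar_functional (fun j => if j is 0%N then x else 0)
    (fun j => if j is 0%N then y else 0) A = dotp (A x) y.
Proof.
apply: cvg_lim => //.
apply: cvg_near_cst; exists 1%N => // -[//|N] _.
rewrite /series/= big_nat_recl//= big1 ?addr0// => j _.
by rewrite linear0 (linear0l dotp).
Qed.

Lemma cvg_series_single (x : F2) :
  cvgn (series (fun j => nrm (if j is 0%N then x else 0) ^+ 2)).
Proof.
apply/cvg_ex; exists (nrm x ^+ 2); apply: cvg_near_cst; exists 1%N => // -[//|N] _.
by rewrite /series/= big_nat_recl//= big1 ?addr0// => j _; rewrite nrm0 expr0n.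
Qed.

Lemma wstar_transfer (c_ : nat -> seq 'I_n -> R[i]) (c : seq 'I_n -> R[i]) :
  (forall k, hol0 (c_ k)) -> hol0 c ->
  wstar_cvg (fun k => fcalc (c_ k) W) (fcalc c W) ->
  wstar_cvg (fun k => fcalc (c_ k) T) (fcalc c T).
Proof.
move=> hc_ hc cW x y cx cy.
(* The vectors [eta (x j) (y j)] have an absolutely convergent sum [z], so the whole w*-functional
   of [f(T)] becomes the single pairing [<f(W) e_0, z>]. *)
have /cvg_ex[z ez] : cvgn (series (fun j => eta (x j) (y j))).
  apply: (@vec_series_cvg _ _ _ (fun j => K * (nrm (x j) ^+ 2 + nrm (y j) ^+ 2))).
    move=> j; rewrite (le_trans (nrm_eta _ _))// ler_wpM2l//.
    by have := sqr_ge0 (nrm (x j) - nrm (y j)); nra.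
  exact/is_cvg_seriesZ/is_cvg_seriesD.
have wE d : hol0 d -> wstar_functional x y (fcalc d T) = dotp (fcalc d W e0) z.
  move=> /hol0_growth[M [r [M1 r1 dMr]]].
  apply: cvg_lim => //.
  rewrite (_ : series _ = (fun N =>
    dotp (fcalc d W e0) (series (fun j => eta (x j) (y j)) N) : R[i]^o)).
    exact: cvg_dotpr.
  apply/funext => N; rewrite /series/= (linear_sumr dotp).
  by apply: eq_bigr => j _; exact: fcalc_transfer dMr.
rewrite (wE _ hc) (_ : (fun k => _) = (fun k => dotp (fcalc (c_ k) W e0) z : R[i]^o)).
  rewrite -wstar_functional_single.
  rewrite (_ : (fun k => _) = (fun k => wstar_functional
    (fun j => if j is 0%N then e0 else 0) (fun j => if j is 0%N then z else 0)
    (fcalc (c_ k) W))).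
    by apply: cW; exact: cvg_series_single.
  by apply/funext => k; rewrite wstar_functional_single.
by apply/funext => k; rewrite (wE _ (hc_ k)).
Qed.

Lemma spectral_radius_fcalc_le (c : seq 'I_n -> R[i]) : hol0 c ->
  spectral_radius (fcalc c T) <= spectral_radius (fcalc c W).
Proof.
move=> /hol0_growth[M [r [M1 r1 cMr]]].
have sW : spectral_radius (fcalc c W) = nrm (c [::]).
  rewrite /spectral_radius (_ : spectrum _ = [set c [::]]) ?image_set1 ?sup1//.
  apply/seteqP; split; first exact: fcalc_spectrum cMr.
  by move=> _ ->; exact: fcalc_shift_spectrum cMr.
rewrite sW /spectral_radius.
(* An empty spectrum, as for the zero space, gives [sup set0 = 0]. *)
have [->|/set0P[z Tz]] := eqVneq (spectrum (fcalc c T)) set0.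
  by rewrite image_set0 sup0 nrm_ge0.
apply: ge_sup; first by exists (nrm z), z.
by move=> _ [u /(fcalc_spectrum T_qn M1 r1 cMr)/= -> <-].
Qed.

Lemma word_creation_vacuum (a : seq 'I_n) :
  word_op (@creation R n) a e0 = fock_basis R a.
Proof.
elim: a => [|i a IH]; first by rewrite /word_op big_nil.
by rewrite /word_op big_cons bopM -/(word_op _ _) IH creationE.
Qed.

(** Evaluate the defining series at the polynomial [e_0]: the [c a] are the coefficients of a Fock
    vector, hence square summable. *)
Lemma creation_calc_coef (c : seq 'I_n -> R[i]) A a :
  creation_calc c A -> A e0 a = c a.
Proof.
have pol : fock_polynomial e0.
  by exists [:: [::]], (fun=> 1); rewrite big_seq1 scale1r.
move=> /(_ _ pol) cA; apply: (cvgn_unique (cvg_coef cA)).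
apply: cvg_near_cst; exists (size a).+1 => // N /= aN.
rewrite /series/= fock_sumE.
under eq_bigr => k _ do rewrite fock_sumE.
pose u b : R[i] := c b * (b == a)%:R.
transitivity (\sum_(0 <= k < N) \sum_(b : k.-tuple 'I_n) u b).
  apply: eq_bigr => k _; apply: eq_bigr => b _.
  by rewrite fockZ word_creation_vacuum /u eq_sym.
rewrite (@sum_level_single _ _ u a)// /u ?eqxx ?mulr1// => b /negPf ->.
by rewrite mulr0.
Qed.

Lemma nrm_fcalc_creation_le (c : seq 'I_n -> R[i]) A : creation_calc c A ->
  nrm (fcalc c T) <= K * power_bound W * nrm A.
Proof.
move=> cA; have cE a := creation_calc_coef a cA.
(* Square summability gives geometric growth with ratio 1, so the calculus converges without
   assuming [hol0]; the added 1 meets the requirement [1 <= M]. *)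
have M1 : 1 <= nrm (A e0) + 1 by rewrite lerDr nrm_ge0.
have cMr : geometric_growth c (nrm (A e0) + 1) 1.
  move=> k; rewrite expr1n mulr1.
  apply: (@le_trans _ _ (nrm (A e0) ^+ 2)).
    apply: le_trans (fock_partial_le (A e0) k.+1).
    rewrite /series/= big_nat_recr//= ler_wpDl//.
      by rewrite sumr_ge0// => j _; apply: level_ge0 => a; exact: sqr_ge0.
    by apply: ler_sum => a _; rewrite cE.
  by rewrite ler_sqr ?nnegrE ?addr_ge0 ?nrm_ge0// lerDl.
have P0 : 0 <= power_bound W.
  rewrite (le_trans (radial_weight_ge0 wB 0))// -[0%N]/(size ([::] : seq 'I_n)).
  exact: radial_weight_le_power_bound.
rewrite (le_trans (nrm_fcalc_le M1 (lexx 1) cMr))// -mulrA ler_wpM2l//.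
(* Coefficientwise, [f(W) e_0] is [A e_0] multiplied by the weights [b_|a|], each at most the power
   bound. *)
apply: (@le_trans _ _ (power_bound W * nrm (A e0))).
  apply: fock_nrm_le => // a.
  rewrite (fcalc_vacuum_coef wB w_noninc w_cvg0 a M1 (lexx 1) cMr) cE nrmM mulrC.
  rewrite ler_wpM2r ?nrm_ge0// nrm_real ger0_norm ?(radial_weight_ge0 wB)//.
  exact: radial_weight_le_power_bound.
by rewrite ler_wpM2l// (le_trans (nrm_bop _ _))// nrm_basis mulr1.
Qed.

End transfer.

Theorem theorem5p7 (R : realType) (n : nat) (H : hilbertType R)
    (T : 'I_n -> bop H) (T_qn : quasi_nilpotent T) :
  exists W : 'I_n -> bop (fock R n),
    weighted_multishift W /\ quasi_nilpotent W /\
    (forall c : seq 'I_n -> R[i], hol0 c ->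
      nrm (fcalc c T) <= pi / Num.sqrt 6 * nrm (fcalc c W)) /\
    (forall c : seq 'I_n -> R[i], hol0 c ->
      spectral_radius (fcalc c T) <= spectral_radius (fcalc c W)) /\
    (forall (c_ : nat -> seq 'I_n -> R[i]) (c : seq 'I_n -> R[i]),
      (forall k, hol0 (c_ k)) -> hol0 c ->
      has_ubound (range (fun k => nrm (fcalc (c_ k) W))) ->
      ((fun k => fcalc (c_ k) W) @ \oo --> fcalc c W ->
       (fun k => fcalc (c_ k) T) @ \oo --> fcalc c T) /\
      (wot_cvg (fun k => fcalc (c_ k) W) (fcalc c W) ->
       wot_cvg (fun k => fcalc (c_ k) T) (fcalc c T)) /\
      (wstar_cvg (fun k => fcalc (c_ k) W) (fcalc c W) ->
       wstar_cvg (fun k => fcalc (c_ k) T) (fcalc c T)) /\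
      (sot_cvg (fun k => fcalc (c_ k) W) (fcalc c W) ->
       sot_cvg (fun k => fcalc (c_ k) T) (fcalc c T))) /\
    (forall (c : seq 'I_n -> R[i]) (A : bop (fock R n)), creation_calc c A ->
      nrm (fcalc c T) <= pi / Num.sqrt 6 * power_bound W * nrm A).
Proof.
have [w [w_bnd w_noninc w_cvg0 w_dom]] := dominating_weights T_qn.
have w_gt0 k : 0 < w k by have /andP[] := w_bnd k.
have wB k : 0 <= w k <= w 0%N by rewrite (ltW (w_gt0 k)) w_noninc.
have K0 : 0 <= (pi / Num.sqrt 6 : R) by rewrite divr_ge0 ?pi_ge0 ?sqrtr_ge0.
have K2 := @pi_sqrt6_sqr R.
exists (@radial_shift R n w _ wB); split; first exact: radial_shift_weighted.
split; first exact: radial_shift_qn.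
split.
  move=> c /hol0_growth[M [r [M1 r1 cMr]]].
  apply: (le_trans (nrm_fcalc_le T_qn w_gt0 wB w_noninc w_cvg0 w_dom K0 K2 M1 r1 cMr)).
  by rewrite ler_wpM2l// (le_trans (nrm_bop _ _))// nrm_basis mulr1.
split; first by move=> c; exact: spectral_radius_fcalc_le.
split; last by move=> c A; exact:
  (nrm_fcalc_creation_le T_qn w_gt0 wB w_noninc w_cvg0 w_dom K0 K2).
move=> c_ c hc_ hc _.
have cvgT := fcalc_cvg_transfer (wB := wB) T_qn w_gt0 w_noninc w_cvg0 w_dom K0 K2 hc_ hc.
split=> [cW|]; first by apply: cvgT; exact: (cvg_bop cW).
split; first exact: (wot_transfer T_qn w_gt0 w_noninc w_cvg0 w_dom K2 hc_ hc).
split; first exact: (wstar_transfer T_qn w_gt0 w_noninc w_cvg0 w_dom K0 K2 hc_ hc).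
(* Strong convergence is used at the vacuum only; the norm convergence it gives for [T] implies the
   strong one. *)
by move=> cW h; apply: cvg_bop; apply: cvgT; exact: cW.
Qed.
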